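(* Let $G$ be a finite, smooth and simply connected domain in the triangular lattice graph $X$. Then the total boundary curvature of $G$ is $12$: $$\sum_{p\in\delta G}K(p)=12,\qquad K(p)=2|S_1(p)|-|S_2(p)|.$$
   Context: $X$ is the infinite triangular lattice graph: its vertices are the points $k(1,0)+l\,(1/2,\sqrt3/2)$ with $k,l\in\mathbb{Z}$, and its edges are the pairs of vertices at Euclidean distance $1$. For a subgraph $G$ of $X$ and a vertex $p$ of $G$, the sphere $S_r(p)$ in $G$ is the graph whose vertices are the vertices of $G$ at geodesic (graph) distance exactly $r$ from $p$ within $G$, and whose edges are all edges of $G$ joining two such vertices. $|S_r(p)|$ denotes the number of edges of $S_r(p)$ (its arc length). Dimension (inductive, for arbitrary graphs): a vertex is $0$-dimensional if it has no neighbours, and a graph is $0$-dimensional if all its vertices are $0$-dimensional (it has no edges). A vertex $p$ is $1$-dimensional if $S_1(p)$ is a nonempty $0$-dimensional graph, and a graph is $1$-dimensional if all its vertices are. A vertex $p$ is $2$-dimensional if $S_1(p)$ is a nonempty $1$-dimensional graph, and a graph is $2$-dimensional if all its vertices are. A vertex $p$ of $G$ is an interior point of $G$ if the sphere $S_1(p)$ in $G$ equals the sphere $S_1(p)$ in $X$ (the full hexagonal $6$-cycle). A vertex $p$ of $G$ is a boundary point of $G$ if it is not an interior point but has a neighbour in $G$ which is an interior point. $\operatorname{int}(G)$ is the set of interior points and $\delta G$ is the set of boundary points. A subgraph $G$ of $X$ (finite or infinite) is a domain if: (i) $G$ is a $2$-dimensional graph; (ii) every vertex of $G$ is an interior point or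 a boundary point; (iii) the set of boundary points, with the edges of $G$ between them, is a $1$-dimensional graph; (iv) if two vertices $p,q$ of $G$ have distance $1$ in $X$, then $(p,q)$ is an edge of $G$ (so $G$ is the induced subgraph on its vertex set); (v) any two distinct interior points of $G$ which have a common neighbouring boundary point either have distance $1$ or are both adjacent to a third interior point of $G$. A domain is finite if it is a finite graph. A domain $G$ is smooth if its complement $G'$, the subgraph of $X$ induced on $X\setminus\operatorname{int}(G)$, is also a domain; then $\delta G=\delta G'$, and $\operatorname{int}(G)$, $\delta G$, $\operatorname{int}(G')$ partition $X$. A domain $G$ with interior $H=\operatorname{int}(G)$ is simply connected if it is nonempty and connected and every closed curve in $H$ can be deformed within $H$ to a trivial (one-point) curve. Here a closed curve in $H$ is a cyclic sequence $x_1,\dots,x_n$ of points of $H$ with consecutive points at distance $1$; a deformation is a finite composition of elementary steps $\{x_1,\dots,x_n\}\to\{y_1,\dots,y_n\}$ with all $x_i,y_i\in H$ and $\sum_i d(x_i,y_i)=1$ (exactly one point is moved, to an adjacent point), where throughout the deformation consecutive points of the cyclic sequence are required to be equal or adjacent. *)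

(* Defs.v *)
From Stdlib Require Import Relation_Operators.
From mathcomp Require Import all_boot all_order all_algebra finmap.
From mathcomp Require Import all_classical.
From mathcomp Require Import realalg.
From mathcomp Require Import ring.

Set Implicit Arguments.
Unset Strict Implicit.
Unset Printing Implicit Defensive.

Import Order.TTheory GRing.Theory Num.Theory.

Local Open Scope classical_set_scope.
Local Open Scope ring_scope.

(* Possibly infinite graphs.  The record carries data only, so that equality of
   graphs is equality of vertex sets and edge relations; [simple_graph] holds
   the graph axioms. *)
Record graph (V : Type) := Graph {
  verts : set V;
  edge : V -> V -> Prop
}.

Definition simple_graph (V : Type) (G : graph V) : Prop :=
  [/\ forall p q, edge G p q -> verts G p /\ verts G q,
      forall p q, edge G p q -> edge G q p
    & forall p, ~ edge G p p].

Definition subgraph (V : Type) (G X : graph V) : Prop :=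
  [/\ simple_graph G, verts G `<=` verts X
    & forall p q, edge G p q -> edge X p q].

Definition induced (V : Type) (X : graph V) (A : set V) : graph V :=
  Graph (verts X `&` A) (fun p q => [/\ A p, A q & edge X p q]).

Fixpoint walk (V : Type) (G : graph V) (n : nat) (p q : V) : Prop :=
  if n is m.+1 then exists2 z, edge G p z & walk G m z q else p = q.

Definition at_dist (V : Type) (G : graph V) (r : nat) (p q : V) : Prop :=
  walk G r p q /\ forall m, (m < r)%N -> ~ walk G m p q.

Definition sphere (V : Type) (G : graph V) (r : nat) (p : V) : graph V :=
  induced G [set q | verts G q /\ at_dist G r p q].

Definition edge_set (V : choiceType) (G : graph V) : set {fset V} :=
  [set e | exists p q, edge G p q /\ e = [fset p; q]%fset].

(* Meaningful when [G] has finitely many edges, [fset_set] of an infinite set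
   being empty. *)
Definition nb_edges (V : choiceType) (G : graph V) : nat :=
  #|` fset_set (edge_set G)|.

Fixpoint vertex_dim (V : Type) (n : nat) (G : graph V) (p : V) : Prop :=
  if n is m.+1 then
    verts (sphere G 1 p) !=set0 /\
    forall q, verts (sphere G 1 p) q -> vertex_dim m (sphere G 1 p) q
  else forall q, ~ edge G p q.

Definition graph_dim (V : Type) (n : nat) (G : graph V) : Prop :=
  forall p, verts G p -> vertex_dim n G p.

Definition connected (V : Type) (G : graph V) : Prop :=
  forall p q, verts G p -> verts G q -> exists n, walk G n p q.

(* The vertex (k, l) stands for the point k(1, 0) + l(1/2, sqrt 3/2).  All the
   coordinates involved are real algebraic numbers. *)
Definition vertex : choiceType := (int * int)%type.

Definition tri_point (u : vertex) : realalg * realalg :=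
  (u.1%:~R + u.2%:~R / 2, u.2%:~R * (Num.sqrt 3 / 2)).

Definition euclid_dist (a b : realalg * realalg) : realalg :=
  Num.sqrt ((a.1 - b.1) ^+ 2 + (a.2 - b.2) ^+ 2).

Definition tri_adj (u v : vertex) : Prop :=
  euclid_dist (tri_point u) (tri_point v) = 1.

Lemma tri_adjE (u v : vertex) :
  tri_adj u v <->
  (u.1 - v.1) ^+ 2 + (u.1 - v.1) * (u.2 - v.2) + (u.2 - v.2) ^+ 2 = 1.
Proof.
rewrite /tri_adj /euclid_dist /tri_point /=.
set E := (X in Num.sqrt X).
set Q := (X in _ <-> X = 1).
have EQ : E = Q%:~R.
  rewrite /E /Q !(rmorphD, rmorphB, rmorphM, rmorphXn) /=.
  have s3 : Num.sqrt 3 ^+ 2 = 3 :> realalg by rewrite sqr_sqrtr ?ler0n.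
  by field: s3.
have E_ge0 : 0 <= E by rewrite addr_ge0 ?sqr_ge0.
split=> [h|h].
  have : E = 1 by rewrite -(sqr_sqrtr E_ge0) h expr1n.
  by rewrite EQ => /eqP; rewrite -[1]/(1%:~R) eqr_int => /eqP.
by rewrite EQ h sqrtr1.
Qed.

Definition tri : graph vertex := Graph setT tri_adj.

Definition interior (G : graph vertex) : set vertex :=
  [set p | verts G p /\ sphere G 1 p = sphere tri 1 p].

Definition boundary (G : graph vertex) : set vertex :=
  [set p | [/\ verts G p, ~ interior G p
             & exists2 q, edge G p q & interior G q]].

Definition domain (G : graph vertex) : Prop :=
  subgraph G tri /\
  [/\ graph_dim 2 G,
      forall p, verts G p -> interior G p \/ boundary G p,
      graph_dim 1 (induced G (boundary G)),
      forall p q, verts G p -> verts G q -> tri_adj p q -> edge G p q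
    & forall p q b, interior G p -> interior G q -> p <> q ->
        boundary G b -> edge G p b -> edge G q b ->
        tri_adj p q \/ exists z, [/\ interior G z, edge G p z & edge G q z]].

Definition finite_graph (G : graph vertex) : Prop := finite_set (verts G).

Definition complement (G : graph vertex) : graph vertex :=
  induced tri (~` interior G).

Definition smooth (G : graph vertex) : Prop := domain (complement G).

(* Closed curves have length n > 0; [ordS] is the cyclic successor on 'I_n. *)
Definition closed_curve (H : set vertex) (n : nat) (x : 'I_n -> vertex) : Prop :=
  (0 < n)%N /\ forall i, H (x i) /\ tri_adj (x i) (x (ordS i)).

(* Intermediate stages of a deformation: consecutive points may coincide. *)
Definition lazy_curve (H : set vertex) (n : nat) (x : 'I_n -> vertex) : Prop :=
  forall i, H (x i) /\ (x i = x (ordS i) \/ tri_adj (x i) (x (ordS i))).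

Definition deform_step (H : set vertex) (n : nat) (x y : 'I_n -> vertex) : Prop :=
  [/\ lazy_curve H x, lazy_curve H y
    & exists2 i, tri_adj (x i) (y i) & forall j, j != i -> x j = y j].

Definition contractible (H : set vertex) (n : nat) (x : 'I_n -> vertex) : Prop :=
  exists c : vertex, clos_refl_trans _ (@deform_step H n) x (fun=> c).

Definition simply_connected (G : graph vertex) : Prop :=
  [/\ verts G !=set0, connected G
    & forall (n : nat) (x : 'I_n -> vertex),
        closed_curve (interior G) x -> contractible (interior G) x].

Definition curvature (G : graph vertex) (p : vertex) : int :=
  2 * (nb_edges (sphere G 1 p))%:Z - (nb_edges (sphere G 2 p))%:Z.

(* Main.v *)
(** Put [h] for the interior and [g] for the vertex set of [G].  Around a boundary
    point [p] the axioms of a domain force the neighbours in [G] to form an arc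
    of [s(p) = |S_1(p)|] edges with [2 <= s(p) <= 4], whose two endpoints are
    exactly the boundary neighbours of [p].  Hence [S_2(p)] is a path, which has
    [2 s(p) - 2] edges coming from the interior neighbours of [p] and [s(q) - 2]
    further edges behind each boundary neighbour [q] of [p], so that
    [K(p)] is the sum of [3 - s(q)] over the two boundary neighbours [q].  The
    total curvature is therefore twice the total turning, the sum of [3 - s(p)].

    By double counting, the total turning is [6 (V - E + F)], where [V], [E] and
    [F] count the vertices, edges and triangles of the interior.  Finally
    [V - E + F = 1] because the rational cochain complex of the interior is exact
    apart from the constants: a closed 1-cochain integrates to [0] along every
    closed curve, as the integral does not change under an elementary
    deformation, and every 2-cochain is a coboundary because triangles in a
    horizontal strip can be integrated one after the other. *)

Require Import Defs.
From HB Require Import structures.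
From mathcomp Require Import all_boot all_order all_algebra finmap all_classical.
From mathcomp Require Import ring lra zify.

Set Implicit Arguments.
Unset Strict Implicit.
Unset Printing Implicit Defensive.

Import Order.TTheory GRing.Theory Num.Theory.

Local Open Scope ring_scope.

(** * Directions and adjacency in the triangular lattice *)

(** The six unit steps in counterclockwise order, indexed modulo 6: adding 1 to the index turns by
    60 degrees, adding 3 reverses the step. *)
Definition dir (j : nat) : vertex :=
  nth (0, 0) [:: (1, 0); (0, 1); (-1, 1); (-1, 0); (0, -1); (1, -1)] (j %% 6).

Lemma dir_mod (j : nat) : dir (j %% 6) = dir j.
Proof. by rewrite /dir modn_mod. Qed.

Lemma dirD6 (j : nat) : dir (j + 6) = dir j.
Proof. by rewrite /dir modnDr. Qed.

Lemma dir_ind (P : vertex -> vertex -> vertex -> vertex -> Prop) (j : nat) :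
  (forall i, (i < 6)%N -> P (dir i) (dir (i + 1)) (dir (i + 2)) (dir (i + 3))) ->
  P (dir j) (dir (j + 1)) (dir (j + 2)) (dir (j + 3)).
Proof.
move=> H; have := H _ (ltn_pmod j (isT : 0 < 6)%N).
by rewrite /dir !modnDml modn_mod.
Qed.

Lemma dir_next (j : nat) : dir j + dir (j + 2) = dir (j + 1).
Proof. by apply: (@dir_ind (fun a b c _ => a + c = b)); do 6?case. Qed.

Lemma dir_opp (j : nat) : dir (j + 3) = - dir j.
Proof. by apply: (@dir_ind (fun a _ _ d => d = - a)); do 6?case. Qed.

Definition adjb (u v : vertex) : bool :=
  (u.1 - v.1) ^+ 2 + (u.1 - v.1) * (u.2 - v.2) + (u.2 - v.2) ^+ 2 == 1.

Lemma adjbP (u v : vertex) : reflect (tri_adj u v) (adjb u v).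
Proof. by apply: (iffP eqP) => /tri_adjE. Qed.

Lemma adjb_sym (u v : vertex) : adjb u v = adjb v u.
Proof.
rewrite /adjb -(opprB v.1) -(opprB v.2).
by congr (_ == _); ring.
Qed.

Lemma adjbb (u : vertex) : adjb u u = false.
Proof. by rewrite /adjb !subrr. Qed.

Lemma adjb_shift (p u v : vertex) : adjb (p + u) (p + v) = adjb u v.
Proof.
have e (a b c : int) : a + b - (a + c) = b - c by ring.
by congr (_ ^+ 2 + _ * _ + _ ^+ 2 == 1); apply: e.
Qed.

Lemma adjb_dir (p : vertex) (j : nat) : adjb p (p + dir j).
Proof.
rewrite -[X in adjb X _]addr0 adjb_shift.
by apply: (@dir_ind (fun a _ _ _ => adjb 0 a)); do 6?case.
Qed.

Lemma adjbE (p q : vertex) : adjb p q -> exists2 j, (j < 6)%N & q = p + dir j.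
Proof.
move=> pq; have {pq}: adjb 0 (q - p) by rewrite -(adjb_shift p) addr0 subrKC.
set x := q - p => px; suff [j j6 xj] : exists2 j, (j < 6)%N & x = dir j.
  by exists j; rewrite // -xj subrKC.
case: x px => a b; rewrite /adjb /= !sub0r => /eqP e.
(* Four times the form is $(2a+b)^2+3b^2$, and symmetrically in $a$ and $b$, so both coordinates are
   at most 1 in absolute value. *)
have a1 : -1 <= a <= 1 by nia.
have b1 : -1 <= b <= 1 by nia.
have : [|| (a == 1) && (b == 0), (a == 0) && (b == 1), (a == -1) && (b == 1),
  (a == -1) && (b == 0), (a == 0) && (b == -1) | (a == 1) && (b == -1)] by nia.
by case/or3P => [||/or4P[]] /andP[/eqP -> /eqP ->];
  [exists 0|exists 1|exists 2|exists 3|exists 4|exists 5].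
Qed.

Lemma fset2_sum (V : zmodType) (a b c d : V) :
  [fset a; b]%fset = [fset c; d]%fset -> a + b = c + d.
Proof.
move=> e.
have ha : a \in [fset c; d]%fset by rewrite -e fset21.
have hb : b \in [fset c; d]%fset by rewrite -e fset22.
have hc : c \in [fset a; b]%fset by rewrite e fset21.
have hd : d \in [fset a; b]%fset by rewrite e fset22.
move: ha hb hc hd => /fset2P[]-> /fset2P[]-> //.
- by move=> _ /fset2P[]->.
- by rewrite addrC.
- by move=> /fset2P[]->.
Qed.

Lemma uniq_map_factor (A B C : eqType) (f : A -> B) (s : A -> C) (L : seq A) :
  (forall x y, f x = f y -> s x = s y) -> uniq (map s L) -> uniq (map f L).
Proof.
move=> fs; elim: L => //= x L IH /andP[xL uL]; rewrite (IH uL) andbT.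
by apply: contra xL => /mapP[y yL /fs ->]; apply: map_f.
Qed.

(** * Counting edges along an induced cycle *)

Definition cyc (R : seq vertex) (j : nat) : vertex := nth 0 R (j %% size R).

(* The cyclic list [R] runs through an induced cycle of the lattice, whose edges
   are told apart by the sum of their endpoints. *)
Definition induced_cycle (R : seq vertex) : bool :=
  let n := size R in
  uniq [seq cyc R j + cyc R j.+1 | j <- iota 0 n] &&
  all (fun i => adjb (cyc R i) (cyc R i.+1) &&
    all (fun j => adjb (cyc R i) (cyc R j) ==>
                  (j == i.+1 %% n)%N || (i == j.+1 %% n)%N) (iota 0 n)) (iota 0 n).

(** An edge of [S] joins two vertices kept by [t], and these are cyclically consecutive because the
    cycle is induced. So the edges correspond to the positions at which both ends are kept. *)
Lemma nb_edges_cycle (S : graph vertex) (p : vertex) (R : seq vertex)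
    (t : vertex -> bool) :
  induced_cycle R ->
  (forall u v, edge S u v <->
    exists x y, [/\ [/\ x \in R, u = p + x & t x],
                    [/\ y \in R, v = p + y & t y] & adjb x y]) ->
  nb_edges S = (\sum_(0 <= j < size R) (t (cyc R j) && t (cyc R j.+1)))%N.
Proof.
move=> /andP[uR /allP aR] SE; set n := size R.
pose L := [seq j <- iota 0 n | t (cyc R j) && t (cyc R j.+1)].
pose f j := [fset (p + cyc R j)%R; (p + cyc R j.+1)%R]%fset.
have inR j : (j < n)%N -> cyc R j \in R.
  by move=> jn; rewrite mem_nth // ltn_pmod // (leq_ltn_trans (leq0n j)).
have cycS j : cyc R (j %% n) = cyc R j by rewrite /cyc modn_mod.
have inRS j : (j < n)%N -> cyc R j.+1 \in R.
  by move=> jn; rewrite -cycS inR // ltn_pmod // (leq_ltn_trans (leq0n j)).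
(* Translation by [p] adds the constant [p + p] to every endpoint sum, so the distinct sums along
   [R] give distinct edges. *)
have uL : uniq (map f L).
  apply: (@uniq_map_factor _ _ _ _ (fun j => cyc R j + cyc R j.+1)).
    move=> i j /fset2_sum; rewrite addrACA [RHS]addrACA => /addrI; exact.
  by apply: subseq_uniq uR; apply: map_subseq; apply: filter_subseq.
have eL : edge_set S = [set` map f L]%classic.
  apply/seteqP; split => e /=.
    move=> [u [v [/SE [x [y [[xR -> tx] [yR -> ty] xy]]] ->]]].
    pose i := index x R; pose j := index y R.
    have iln : (i < n)%N by rewrite index_mem.
    have jln : (j < n)%N by rewrite index_mem.
    have xi : x = cyc R i by rewrite /cyc modn_small // nth_index.
    have yj : y = cyc R j by rewrite /cyc modn_small // nth_index.
    have /aR /andP[_ /allP aRi] : i \in iota 0 n by rewrite mem_iota.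
    have /aRi : j \in iota 0 n by rewrite mem_iota.
    rewrite -xi -yj xy /= => /orP[] /eqP ej; apply/mapP.
      exists i; last by rewrite /f -xi -cycS -ej -yj.
      by rewrite mem_filter mem_iota -xi tx -cycS -ej -yj ty.
    exists j; last by rewrite /f -yj -cycS -ej -xi fsetUC.
    by rewrite mem_filter mem_iota -yj ty -cycS -ej -xi tx.
  move=> /mapP[j]; rewrite mem_filter mem_iota => /andP[/andP[tj tj1] /= jn] ->.
  exists (p + cyc R j), (p + cyc R j.+1); split=> //; apply/SE.
  exists (cyc R j), (cyc R j.+1); split.
  - by split; rewrite ?inR.
  - by split; rewrite ?inRS.
  - have /aR /andP[] // : j \in iota 0 n by rewrite mem_iota.
have -> : nb_edges S = size (map f L).
  rewrite /nb_edges eL.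
  have -> : [set` map f L]%classic = [set` [fset x in map f L]%fset]%classic.
    by apply/seteqP; split=> x /=; rewrite in_fset.
  by rewrite set_fsetK card_fseq undup_id.
by rewrite size_map size_filter -sum1_count big_mkcond /= /index_iota subn0.
Qed.

Definition ring1 : seq vertex := [seq dir j | j <- iota 0 6].

(** The hexagon of radius 2 about the origin in cyclic order: position [2 * j] lies straight in
    direction [j], position [2 * j + 1] between directions [j] and [j + 1]. *)
Definition ring2 : seq vertex :=
  flatten [seq [:: dir j + dir j; dir j + dir j.+1] | j <- iota 0 6].

Lemma ring1_cycle : induced_cycle ring1. Proof. by vm_compute. Qed.
Lemma ring2_cycle : induced_cycle ring2. Proof. by vm_compute. Qed.

(** * Cyclic sums and patterns of period six *)

Lemma sum_rot6 (V : nmodType) (F : nat -> V) (i : nat) :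
  (forall k, F (k + 6)%N = F k) ->
  \sum_(0 <= k < 6) F (i + k)%N = \sum_(0 <= k < 6) F k.
Proof.
move=> per; elim: i => [|i IH]; first by apply: eq_bigr.
rewrite -IH big_nat_recr //= [RHS]big_nat_recl //= addSn -addnS per addn0.
by rewrite addrC; congr (_ + _); apply: eq_bigr => k _; rewrite addSnnS.
Qed.

Lemma sum6 (V : nmodType) (F : nat -> V) :
  \sum_(0 <= k < 6) F k = F 0%N + F 1%N + F 2%N + F 3%N + F 4%N + F 5%N.
Proof. by rewrite !big_nat_recr //= big_geq // add0r. Qed.

Lemma dir6 (P : nat -> Prop) :
  (forall k, (k < 6)%N -> P k) -> (forall k, P k -> P (k + 6)%N) ->
  forall k, P k.
Proof.
move=> P6 PS k; rewrite (divn_eq k 6) addnC.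
elim: (k %/ 6)%N => [|q IH]; first by rewrite addn0; apply: P6; rewrite ltn_pmod.
by rewrite mulSnr addnA; apply: PS.
Qed.

(** Here [g] marks the neighbours of a boundary point that lie in the domain, [h] the interior ones.
    Each maximal run of [g] contains an edge, hence an [h], hence at least three vertices, and two
    separate runs of that size do not fit on a hexagon. Inside the single run, two adjacent points
    outside [h] are excluded by the edge condition and an isolated one by convexity. The formal
    proof exhausts the six values of each function. *)
Lemma arc_pattern (g h : nat -> bool) :
  (forall k, g (k + 6)%N = g k) -> (forall k, h (k + 6)%N = h k) ->
  (forall k, h k -> [&& g k, g (k + 1)%N & g (k + 5)%N]) ->
  (forall k, g k -> g (k + 1)%N || g (k + 5)%N) ->
  (exists k, h k) -> (exists k, ~~ g k) ->
  (forall k, g k -> g (k + 1)%N -> h k || h (k + 1)%N) ->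
  (forall k, h k -> h (k + 2)%N -> h (k + 1)%N) ->
  exists i s, (2 <= s <= 4)%N /\
    forall k, (k < 6)%N -> g (i + k)%N = (k <= s)%N /\ h (i + k)%N = (0 < k < s)%N.
Proof.
move=> gper hper hg gg [kh hkh] [kg gkg] ghh hhh.
pose gl := [:: g 0; g 1; g 2; g 3; g 4; g 5]%N.
pose hl := [:: h 0; h 1; h 2; h 3; h 4; h 5]%N.
have gE k : g k = nth false gl (k %% 6).
  elim/dir6: k => [|k IH]; first by do 6?case.
  by rewrite gper modnDr.
have hE k : h k = nth false hl (k %% 6).
  elim/dir6: k => [|k IH]; first by do 6?case.
  by rewrite hper modnDr.
pose G k := nth false gl (k %% 6); pose H k := nth false hl (k %% 6).
pose I := iota 0 6.
suff : has (fun i => has (fun s => all (fun k => (G (i + k)%N == (k <= s)%N) &&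
         (H (i + k)%N == (0 < k < s)%N)) I) [:: 2; 3; 4]%N) I.
  move=> /hasP[i _ /hasP[s s4 /allP gh]]; exists i, s; split.
    by move: s4; rewrite !inE => /or3P[] /eqP->.
  move=> k k6; have /gh /andP[/eqP <- /eqP <-] : k \in I by rewrite mem_iota.
  by rewrite gE hE.
have c1 : ~~ all G I.
  rewrite -has_predC; apply/hasP; exists (kg %% 6)%N.
    by rewrite mem_iota ltn_pmod.
  by rewrite /= /G modn_mod -gE.
have c2 : all (fun k => G k ==> G (k + 1)%N || G (k + 5)%N) I.
  by apply/allP => k _; rewrite /G -!gE; apply/implyP/gg.
have c3 : has H I.
  apply/hasP; exists (kh %% 6)%N; first by rewrite mem_iota ltn_pmod.
  by rewrite /= /H modn_mod -hE.
have c4 : all (fun k => H k ==> [&& G k, G (k + 1)%N & G (k + 5)%N]) I.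
  by apply/allP => k _; rewrite /G /H -!gE -!hE; apply/implyP/hg.
have c5 : all (fun k => G k && G (k + 1)%N ==> H k || H (k + 1)%N) I.
  apply/allP => k _; rewrite /G /H -!gE -!hE.
  by apply/implyP => /andP[]; apply: ghh.
have c6 : all (fun k => H k && H (k + 2)%N ==> H (k + 1)%N) I.
  by apply/allP => k _; rewrite /H -!hE; apply/implyP => /andP[]; apply: hhh.
move: c1 c2 c3 c4 c5 c6; rewrite /G /H /gl /hl /I.
move: (g 0) (g 1) (g 2) (g 3) (g 4) (g 5)%N; do 6 case=> //;
move: (h 0) (h 1) (h 2) (h 3) (h 4) (h 5)%N; by do 6 case.
Qed.

(** * Local geometry at a boundary point *)

Definition nb (p : vertex) (j : nat) : vertex := p + dir j.

Lemma nbD6 (p : vertex) (j : nat) : nb p (j + 6) = nb p j.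
Proof. by rewrite /nb dirD6. Qed.

Lemma nbC (p : vertex) (i j : nat) : nb (nb p i) j = nb (nb p j) i.
Proof. exact: addrAC. Qed.

Lemma nb_next (p : vertex) (j : nat) : nb (nb p j) (j + 2) = nb p (j + 1).
Proof. by rewrite /nb -addrA dir_next. Qed.

Lemma nb_opp (p : vertex) (j : nat) : nb (nb p j) (j + 3) = p.
Proof. by rewrite /nb -addrA dir_opp subrr addr0. Qed.

Lemma nb_prev (p : vertex) (j : nat) : nb (nb p j) (j + 4) = nb p (j + 5).
Proof. by have := nb_next p (j + 4); rewrite -!addnA nbD6 nbC. Qed.

(** The local content of the axioms of a domain, with [g] for its vertices and [h] for its interior:
    [patch_edge] reflects dimension 2 of the graph, [patch_tri] dimension 1 of the boundary, and
    [patch_conv] the axiom on interior points with a common boundary neighbour. *)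
Record patch (g h : vertex -> bool) : Prop := Patch {
  patch_int p : h p -> g p;
  patch_nbr p j : h p -> g (nb p j);
  patch_bnd p : g p -> ~~ h p -> exists j, ~~ g (nb p j);
  patch_edge p j : g p -> g (nb p j) -> g (nb p (j + 1)) || g (nb p (j + 5));
  patch_near p : g p -> ~~ h p -> exists j, h (nb p j);
  patch_tri p j : g p -> ~~ h p -> g (nb p j) -> g (nb p (j + 1)) ->
    h (nb p j) || h (nb p (j + 1));
  patch_conv p j : g p -> ~~ h p -> h (nb p j) -> h (nb p (j + 2)) ->
    h (nb p (j + 1)) }.

Definition len1 (g : vertex -> bool) (p : vertex) : nat :=
  \sum_(0 <= j < 6) (g (nb p j) && g (nb p (j + 1))).

(* The two kinds of points at distance 2 from [p]: those in line with the neighbour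
   [nb p j], and those adjacent to both [nb p j] and [nb p (j + 1)]. *)
Definition corner (g : vertex -> bool) (p : vertex) (j : nat) : bool :=
  g (nb p j) && g (nb (nb p j) j).

Definition middle (g : vertex -> bool) (p : vertex) (j : nat) : bool :=
  (g (nb p j) || g (nb p (j + 1))) && g (nb (nb p j) (j + 1)).

(** Corners and middles alternate along the hexagon of radius 2; the two summands of index [j] are
    the two edges at middle [j]. *)
Definition len2 (g : vertex -> bool) (p : vertex) : nat :=
  \sum_(0 <= j < 6) ((corner g p j && middle g p j) +
                     (middle g p j && corner g p (j + 1))).

Lemma patch_arc (g h : vertex -> bool) (p : vertex) :
  patch g h -> g p -> ~~ h p ->
  exists i s, (2 <= s <= 4)%N /\
    forall k, (k < 6)%N -> g (nb p (i + k)) = (k <= s)%N /\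
                           h (nb p (i + k)) = (0 < k < s)%N.
Proof.
move=> P gp hp.
apply: (@arc_pattern (fun k => g (nb p k)) (fun k => h (nb p k))).
- by move=> k; rewrite nbD6.
- by move=> k; rewrite nbD6.
- move=> k hk; rewrite -nb_next -nb_prev.
  by rewrite (patch_int P hk) !(patch_nbr P).
- by move=> k gk; apply: (patch_edge P).
- exact: (patch_near P).
- exact: (patch_bnd P).
- by move=> k; apply: (patch_tri P).
- by move=> k; apply: (patch_conv P).
Qed.

Lemma sum_nb (F : vertex -> vertex -> nat) (p : vertex) (i : nat) :
  (\sum_(0 <= j < 6) F (nb p j) (nb p (j + 1)) =
  F (nb p (i + 0)) (nb p (i + 1)) + F (nb p (i + 1)) (nb p (i + 2)) +
  F (nb p (i + 2)) (nb p (i + 3)) + F (nb p (i + 3)) (nb p (i + 4)) +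
  F (nb p (i + 4)) (nb p (i + 5)) + F (nb p (i + 5)) (nb p (i + 0)))%N.
Proof.
rewrite -(@sum_rot6 _ (fun j => F (nb p j) (nb p (j + 1))) i) => [|k].
  have e5 : nb p (i + 5 + 1) = nb p (i + 0) by rewrite -addnA nbD6 addn0.
  by rewrite sum6 e5 -(addnA i 1%N) -(addnA i 2%N) -(addnA i 3%N) -(addnA i 4%N) addn0.
by rewrite addnAC !nbD6.
Qed.

(** An arc of $s$ edges has $s-1$ interior vertices and $s-2$ edges between them. This expresses the
    turning $3-s$ through interior counts alone. *)
Lemma patch_turn (g h : vertex -> bool) (p : vertex) :
  patch g h -> g p -> ~~ h p ->
  (\sum_(0 <= j < 6) h (nb p j) + len1 g p =
   3 + 2 * \sum_(0 <= j < 6) (h (nb p j) && h (nb p (j + 1))))%N.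
Proof.
move=> P gp hp; have [i [s [s4 gh]]] := patch_arc P gp hp.
rewrite /len1 (sum_nb (fun x _ => h x) p i) (sum_nb (fun x y => g x && g y) p i).
rewrite (sum_nb (fun x y => h x && h y) p i).
have [-> ->] := gh 0%N isT; have [-> ->] := gh 1%N isT.
have [-> ->] := gh 2%N isT; have [-> ->] := gh 3%N isT.
have [-> ->] := gh 4%N isT; have [-> ->] := gh 5%N isT.
by clear gh; case: s s4 => [|[|[|[|[]]]]].
Qed.

(** These neighbours are the two ends of the arc. *)
Lemma patch_bnd_nbrs (g h : vertex -> bool) (p : vertex) :
  patch g h -> g p -> ~~ h p ->
  (\sum_(0 <= j < 6) (g (nb p j) && ~~ h (nb p j)) = 2)%N.
Proof.
move=> P gp hp; have [i [s [s4 gh]]] := patch_arc P gp hp.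
rewrite (sum_nb (fun x _ => g x && ~~ h x) p i).
have [-> ->] := gh 0%N isT; have [-> ->] := gh 1%N isT.
have [-> ->] := gh 2%N isT; have [-> ->] := gh 3%N isT.
have [-> ->] := gh 4%N isT; have [-> ->] := gh 5%N isT.
by clear gh; case: s s4 => [|[|[|[|[]]]]].
Qed.

(** Seen from [p], the six neighbours of [nb p r] are a corner [C] with the middles [M] and [N] on
    its two sides, the neighbours [A] and [B] of [p], and [p] itself. *)
Lemma len1_nb (g : vertex -> bool) (p : vertex) (r : nat) :
  let A := g (nb p (r + 1)) in let B := g (nb p (r + 5)) in
  let C := g (nb (nb p r) r) in let M := g (nb (nb p r) (r + 1)) in
  let N := g (nb (nb p (r + 5)) (r + 5 + 1)) in
  len1 g (nb p r) =
  ((C && M) + (M && A) + (A && g p) + (g p && B) + (B && N) + (N && C))%N.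
Proof.
move=> A B C M N; rewrite /len1 (sum_nb (fun x y => g x && g y) _ r).
rewrite addn0 nb_next nb_opp nb_prev /N -(addnA r 5%N 1%N) (nbD6 _ r).
by rewrite /M /C [nb (nb p (r + 5)) r]nbC.
Qed.

(** The count behind the curvature formula: $S_2(p)$ has $2s-2$ edges coming from the interior
    neighbours and $s(q)-2$ more behind each end $q$ of the arc, so $2s-|S_2(p)|$ is the sum of
    $3-s(q)$ over both ends. [C] and [M] tell which corners and middles lie in the domain. *)
Lemma arc_curvature (A H C M : nat -> bool) (s : nat) : (2 <= s <= 4)%N ->
  (forall k, A (k + 6)%N = A k) -> (forall k, C (k + 6)%N = C k) ->
  (forall k, M (k + 6)%N = M k) ->
  (forall k, (k < 6)%N -> A k = (k <= s)%N /\ H k = (0 < k < s)%N) ->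
  (forall k, H k -> [&& C k, M k & M (k + 5)%N]) ->
  (forall k, A k -> M k -> A (k + 1)%N || C k) ->
  (forall k, A k -> M (k + 5)%N -> C k || A (k + 5)%N) ->
  2 * (\sum_(0 <= k < 6) (A k && A (k + 1)))%N%:Z -
    (\sum_(0 <= k < 6)
       (((A k && C k) && ((A k || A (k + 1)) && M k)) +
        (((A k || A (k + 1)) && M k) && (A (k + 1) && C (k + 1)))))%N%:Z =
  \sum_(0 <= k < 6) (A k && ~~ H k)%:Z *
    (3 - ((C k && M k) + (M k && A (k + 1)) + (A (k + 1) && true) +
          (true && A (k + 5)) + (A (k + 5) && M (k + 5)) + (M (k + 5) && C k))%N%:Z).
Proof.
move=> s4 Aper Cper Mper AH HCM MC CM.
have E (F : nat -> bool) : (forall k, F (k + 6)%N = F k) ->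
    exists f : 6.-tuple bool, forall k, F k = nth false f (k %% 6).
  move=> Fper; exists [tuple F 0%N; F 1%N; F 2; F 3; F 4; F 5].
  elim/dir6 => [|k IH]; first by do 6?case.
  by rewrite Fper modnDr.
have AE k : A k = (k %% 6 <= s)%N.
  elim/dir6: k => [k k6|k IH]; last by rewrite Aper modnDr.
  by rewrite (AH k k6).1 modn_small.
have [[c cs] CE] := E C Cper; have [[m ms] ME] := E M Mper.
have HE k : (k < 6)%N -> H k = (0 < k < s)%N by move=> /AH[].
(* The interior positions are among 1, 2, 3. At the ends [s] and 0 the next position off the arc is
   empty, so a middle beyond the end forces the corner behind it. *)
have HCM1 := HCM 1%N; have HCM2 := HCM 2%N; have HCM3 := HCM 3%N.
have MCs := MC s; have CM0 := CM 0%N.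
clear HCM MC CM AH Aper Cper Mper E.
rewrite !sum6 !AE !CE !ME !HE //= in HCM1 HCM2 HCM3 MCs CM0 *.
clear AE CE ME HE.
case: c cs HCM1 HCM2 HCM3 MCs CM0 => [|c0 [|c1 [|c2 [|c3 [|c4 [|c5 []]]]]]] //= _.
case: m ms => [|m0 [|m1 [|m2 [|m3 [|m4 [|m5 []]]]]]] //= _.
case: s s4 => [|[|[|[|[]]]]] // _ /=; rewrite !mul0r.
- move=> /(_ isT)/and3P[-> -> ->] _ _.
  by case: c0; case: c2; case: m2; case: m5 => // /(_ isT isT) // _ /(_ isT isT).
- move=> /(_ isT)/and3P[-> -> ->] /(_ isT)/and3P[-> -> _] _.
  by case: c0; case: c3; case: m3; case: m5 => // /(_ isT isT) // _ /(_ isT isT).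
- move=> /(_ isT)/and3P[-> -> ->] /(_ isT)/and3P[-> -> _] /(_ isT)/and3P[-> -> _].
  by case: c0; case: c4; case: m4; case: m5 => // /(_ isT isT) // _ /(_ isT isT).
Qed.

Lemma patch_curvature (g h : vertex -> bool) (p : vertex) :
  patch g h -> g p -> ~~ h p ->
  2 * (len1 g p)%:Z - (len2 g p)%:Z =
  \sum_(0 <= j < 6)
     (g (nb p j) && ~~ h (nb p j))%:Z * (3 - (len1 g (nb p j))%:Z).
Proof.
move=> P gp hp; have [i [s [s4 gh]]] := patch_arc P gp hp.
have cper k : corner g p (k + 6) = corner g p k by rewrite /corner !nbD6.
have mper k : middle g p (k + 6) = middle g p k.
  by rewrite /middle addnAC !nbD6.
rewrite {1}/len1 -(@sum_rot6 _ (fun j => (g (nb p j) && g (nb p (j + 1)) : nat)) i);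
  last by move=> k; rewrite addnAC !nbD6.
rewrite /len2 -(@sum_rot6 _ (fun j => (corner g p j && middle g p j) +
   (middle g p j && corner g p (j + 1)))%N i); last first.
  by move=> k; rewrite cper mper addnAC cper.
rewrite -[RHS](@sum_rot6 _ (fun j => (g (nb p j) && ~~ h (nb p j))%:Z *
                               (3 - (len1 g (nb p j))%:Z)) i); last first.
  by move=> k; rewrite nbD6.
pose A k := g (nb p (i + k)); pose H k := h (nb p (i + k)).
pose C k := g (nb (nb p (i + k)) (i + k)).
pose M k := g (nb (nb p (i + k)) (i + (k + 1))).
(* A middle is reached from both neighbours of [p] next to it; this one is reread from the later of
   the two. *)
have Mprev k : M (k + 5)%N = g (nb (nb p (i + k)) (i + k + 5)).
  by rewrite /M -(addnA k 5%N 1%N) (addnA i k 5%N) (addnA i k (5 + 1)%N) nbD6 nbC.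
apply: etrans (etrans (@arc_curvature A H C M s s4 _ _ _ gh _ _ _) _).
- by congr (2 * _%:Z - _%:Z); apply: eq_bigr => k _; rewrite /A /C /M ?addnA.
- by move=> k; rewrite /A addnA nbD6.
- by move=> k; rewrite /C addnA !nbD6.
- by move=> k; rewrite /M (addnAC k 6%N 1%N) !addnA !nbD6.
- by move=> k hk; rewrite Mprev /C /M !(patch_nbr P).
- move=> k gk; rewrite /M /A /C !addnA => /(patch_edge P gk).
  by rewrite -[(i + k + 1 + 1)%N]addnA nb_next -(addnA (i + k) 1%N 5%N) nbD6.
- move=> k gk; rewrite Mprev /A /C => /(patch_edge P gk).
  rewrite -(addnA (i + k) 5%N 1%N) nbD6 -(addnA (i + k) 5%N 5%N).
  by rewrite (addnA (i + k) 4%N 6%N) nbD6 nb_prev addnA.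
apply: eq_bigr => k _; rewrite len1_nb gp Mprev -/(A k) -/(H k).
rewrite /A /C /M !addnA -(addnA (i + k)%N 5%N 1%N) nbD6.
by rewrite [nb (nb p (i + k + 5)) _]nbC.
Qed.

(** * Common neighbours of lattice points *)

Lemma dir_modD (j m : nat) : dir (j %% 6 + m) = dir (j + m).
Proof. by rewrite /dir modnDml. Qed.

Lemma allI6 (P : nat -> nat -> bool) :
  all (fun i => all (P i) (iota 0 6)) (iota 0 6) ->
  forall i j, P (i %% 6)%N (j %% 6)%N.
Proof.
move=> /allP H i j; have /H /allP : (i %% 6)%N \in iota 0 6.
  by rewrite mem_iota ltn_pmod.
by apply; rewrite mem_iota ltn_pmod.
Qed.

Lemma nbE (p q : vertex) : adjb p q -> exists j, q = nb p j.
Proof. by move=> /adjbE[j _ ->]; exists j. Qed.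

Lemma nb_common (p q : vertex) (j : nat) :
  adjb p q -> adjb (nb p j) q -> q = nb p (j + 1) \/ q = nb p (j + 5).
Proof.
move=> /nbE[i ->]; rewrite /nb adjb_shift.
have := @allI6 (fun j i => adjb (dir j) (dir i) ==>
  (dir i == dir (j + 1)) || (dir i == dir (j + 5))) isT j i.
by rewrite !dir_mod !dir_modD => /implyP e /e /orP[]/eqP->; [left|right].
Qed.

Lemma nb_common2 (p q : vertex) (j : nat) :
  adjb (nb p j) q -> adjb (nb p (j + 2)) q -> q = p \/ q = nb p (j + 1).
Proof.
move=> /nbE[i ->]; rewrite /nb -addrA adjb_shift.
have := @allI6 (fun j i => adjb (dir (j + 2)) (dir j + dir i) ==>
  (dir j + dir i == 0) || (dir j + dir i == dir (j + 1))) isT j i.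
rewrite !dir_mod !dir_modD => /implyP e /e /orP[]/eqP->; last by right.
by left; rewrite addr0.
Qed.

Lemma nb_nadj2 (p : vertex) (j : nat) : adjb (nb p j) (nb p (j + 2)) = false.
Proof.
rewrite /nb adjb_shift.
have := @allI6 (fun j _ => ~~ adjb (dir j) (dir (j + 2))) isT j 0%N.
by rewrite dir_mod dir_modD => /negbTE.
Qed.

Lemma nb_neq2 (p : vertex) (j : nat) : nb p j <> nb p (j + 2).
Proof.
move=> /addrI; have := @allI6 (fun j _ => dir j != dir (j + 2)) isT j 0%N.
by rewrite dir_mod dir_modD => /eqP.
Qed.

(** * From the axioms of a domain to patches and arc lengths *)

Lemma graph_ext (V : Type) (G H : graph V) :
  (forall p, verts G p <-> verts H p) ->
  (forall p q, edge G p q <-> edge H p q) -> G = H.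
Proof.
case: G H => [VG EG] [VH EH] /= hv he; congr Graph.
  by apply/seteqP; split=> p /hv.
by apply/funext => p; apply/funext => q; apply/propext.
Qed.

Lemma simple_tri : simple_graph tri.
Proof.
split=> // [p q /adjbP|p /adjbP]; last by rewrite adjbb.
by rewrite adjb_sym => /adjbP.
Qed.

Lemma sphere1_verts (G : graph vertex) (p q : vertex) :
  simple_graph G -> verts (sphere G 1 p) q <-> edge G p q.
Proof.
move=> [Gv Gs Gi]; split=> [[_ [_ [[z pz <-]]]]//|pq].
split; first by case: (Gv _ _ pq).
split; first by case: (Gv _ _ pq).
split; first by exists q.
by case=> // _ /= e; apply: (Gi p); rewrite {2}e.
Qed.

Lemma sphere1_edge (G : graph vertex) (p u v : vertex) : simple_graph G ->
  edge (sphere G 1 p) u v <-> [/\ edge G p u, edge G p v & edge G u v].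
Proof.
move=> sG; have S q := sphere1_verts p q sG.
have [Gv _ _] := sG; split=> [[hu hv uv]|[/S [_ hu] /S [_ hv] uv]] //.
by have [gu gv] := Gv _ _ uv; split=> //; apply/S; split.
Qed.

Definition vertb (G : graph vertex) (p : vertex) : bool := `[< verts G p >].

Definition intb (G : graph vertex) (p : vertex) : bool := `[< interior G p >].

Section DomainPatch.
Variables (G : graph vertex) (domG : domain G).

Let simpleG : simple_graph G. Proof. by case: domG => -[]. Qed.

Lemma domain_edge (p q : vertex) :
  edge G p q <-> [/\ verts G p, verts G q & adjb p q].
Proof.
have [[[Gv _ _] _ Ga] [_ _ _ Gi _]] := domG.
split=> [pq|[gp gq /adjbP]]; last exact: Gi.
by have [gp gq] := Gv _ _ pq; split=> //; apply/adjbP/Ga.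
Qed.

(** A domain is an induced subgraph, so equality of the two unit spheres is decided on vertices. *)
Lemma interiorE (p : vertex) :
  interior G p <-> verts G p /\ forall j, verts G (nb p j).
Proof.
split=> [[gp e]|[gp gn]].
  split=> // j; have : verts (sphere tri 1 p) (nb p j).
    by apply/(sphere1_verts _ _ simple_tri)/adjbP/adjb_dir.
  by rewrite -e => -[].
split=> //; have E q : edge G p q <-> edge tri p q.
  split=> [/domain_edge[_ _ /adjbP]//|/adjbP pq]; apply/domain_edge.
  by split=> //; have [j ->] := nbE pq.
apply: graph_ext => [q|u v].
  by split=> [/(sphere1_verts _ _ simpleG)/E|/(sphere1_verts _ _ simple_tri)/E] H;
    apply/sphere1_verts => //; apply: simple_tri.
split=> [/(sphere1_edge _ _ _ simpleG)|/(sphere1_edge _ _ _ simple_tri)] [hu hv uv].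
  apply/(sphere1_edge _ _ _ simple_tri); split; [exact/E|exact/E|].
  by case/domain_edge: uv => _ _ /adjbP.
apply/(sphere1_edge _ _ _ simpleG); split; [exact/E|exact/E|].
apply/domain_edge; move/E/domain_edge: hu => [_ gu _].
by move/E/domain_edge: hv => [_ gv _]; split=> //; apply/adjbP.
Qed.

Local Notation g := (vertb G).
Local Notation h := (intb G).

Lemma not_interior_boundary (p : vertex) : g p -> ~~ h p -> boundary G p.
Proof.
have [_ [_ GB _ _ _]] := domG.
by move=> /asboolP gp /asboolP hp; case: (GB p gp).
Qed.

Lemma domain_patch : patch g h.
Proof.
have [_ [dim2 GB dim1 _ conv]] := domG.
have gP p : g p -> verts G p by move/asboolP.
have hP p : h p -> interior G p by move/asboolP.
split.
- by move=> p /hP[gp _]; apply/asboolP.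
- by move=> p j /hP/interiorE[_ gn]; apply/asboolP.
- move=> p /gP gp /asboolP hp; apply/not_existsP => gn.
  apply/hp/interiorE; split=> // j.
  by apply/gP/negPn/negP/gn.
(* Dimension 2 gives [nb p j] a neighbour inside $S_1(p)$, which is one of the two common neighbours
   of [p] and [nb p j]. *)
- move=> p j /gP gp /gP gj.
  have pj : edge G p (nb p j) by apply/domain_edge; split=> //; apply: adjb_dir.
  have [_ /(_ (nb p j))] := dim2 p gp.
  case; first exact/sphere1_verts.
  case=> r [_ [_ [[z /(sphere1_edge _ _ _ simpleG)[_ pz jz] <-]]]] _ _.
  have /domain_edge[_ gz pz'] := pz; have /domain_edge[_ _ jz'] := jz.
  have [ez|ez] := nb_common pz' jz'; rewrite -ez; apply/orP.
    by left; apply/asboolP.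
  by right; apply/asboolP.
- move=> p gp hp; have [_ _ [q /domain_edge[_ _ /nbE[j ->]] hq]] :=
    not_interior_boundary gp hp.
  by exists j; apply/asboolP.
(* A triangle of boundary points would put an edge into a unit sphere of the boundary, which must be
   0-dimensional. *)
- move=> p j gp hp gj gk; apply/negPn; rewrite negb_or; apply/negP => /andP[hj hk].
  have bp := not_interior_boundary gp hp.
  have bj := not_interior_boundary gj hj; have bk := not_interior_boundary gk hk.
  set B := induced G (boundary G) in dim1.
  have Bedge u v : boundary G u -> boundary G v -> adjb u v -> edge B u v.
    move=> bu bv uv; split=> //; apply/domain_edge.
    by split=> //; [case: bu|case: bv].
  have sB : simple_graph B.
    have [Gv Gs Gi] := simpleG; split=> [u v [bu bv uv]|u v [bu bv uv]|u [_ _]].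
    - by have [gu gv] := Gv _ _ uv.
    - by split=> //; apply: Gs.
    - exact: Gi.
  have pj : edge B p (nb p j) by apply: Bedge => //; apply: adjb_dir.
  have pk : edge B p (nb p (j + 1)) by apply: Bedge => //; apply: adjb_dir.
  have [_ /(_ (nb p j))] := dim1 p (conj (gP _ gp) bp).
  move=> /(_ (iffRL (sphere1_verts _ _ sB) pj))/(_ (nb p (j + 1))); apply.
  apply/(sphere1_edge _ _ _ sB); split=> //; apply: Bedge => //.
  by rewrite -nb_next; apply: adjb_dir.
(* The two interior points are not adjacent, so they share an interior neighbour; it is [p] or
   [nb p (j + 1)], and [p] is not interior. *)
- move=> p j gp hp hj hk; have bp := not_interior_boundary gp hp.
  have e1 : edge G (nb p j) p.
    apply/domain_edge; split; [by case: (hP _ hj)|exact: gP|].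
    by rewrite adjb_sym; apply: adjb_dir.
  have e2 : edge G (nb p (j + 2)) p.
    apply/domain_edge; split; [by case: (hP _ hk)|exact: gP|].
    by rewrite adjb_sym; apply: adjb_dir.
  have [| /adjbP|[z [iz /domain_edge[_ _ jz] /domain_edge[_ _ kz]]]] :=
    conv _ _ p (hP _ hj) (hP _ hk) _ bp e1 e2.
  + exact: nb_neq2.
  + by rewrite nb_nadj2.
  have [zp|<-] := nb_common2 jz kz; last exact/asboolP.
  by case: bp => _ /(_ _)[]; rewrite -zp.
Qed.
Lemma nb_edges_sphere1 (p : vertex) :
  g p -> nb_edges (sphere G 1 p) = len1 g p.
Proof.
move=> /asboolP gp; rewrite (@nb_edges_cycle _ p ring1 (fun x => g (p + x))).
- by rewrite /len1 !sum6.
- exact: ring1_cycle.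
have ringP j : dir j \in ring1.
  by rewrite -dir_mod map_f // mem_iota ltn_pmod.
move=> u v; split=> [/(sphere1_edge _ _ _ simpleG)|].
  move=> [/domain_edge[_ /asboolP gu /nbE[i ei]]].
  move=> /domain_edge[_ /asboolP gv /nbE[j ej]] /domain_edge[_ _ uv].
  exists (dir i), (dir j); rewrite -[p + dir i]ei -[p + dir j]ej.
  by split=> //; move: uv; rewrite ei ej adjb_shift.
move=> [x [y [[/mapP[i _ ->] -> /asboolP gx] [/mapP[j _ ->] -> /asboolP gy] xy]]].
apply/(sphere1_edge _ _ _ simpleG); split; apply/domain_edge; split=> //;
  rewrite ?adjb_shift //; exact: adjb_dir.
Qed.

(* The filtered list holds the directions of the common neighbours of [p] and
   [p + x]. *)
Definition at2 (p x : vertex) : bool :=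
  has (fun i => g (nb p i)) [seq i <- iota 0 6 | adjb (dir i) x] && g (p + x).

(** Two unit steps sum to 0, to a point of [ring1] or to a point of [ring2]. In the first two cases
    the endpoint has distance at most 1 within [G], because [G] is induced. *)
Lemma sphere2_verts (p q : vertex) : g p ->
  verts (sphere G 2 p) q <-> exists x, [/\ x \in ring2, q = p + x & at2 p x].
Proof.
move=> /asboolP gp; split.
  move=> [_ [gq [[z pz [q' zq eq']] far]]]; subst q'.
  have /domain_edge[_ gz /nbE[j ez]] := pz.
  have /domain_edge[_ _ /nbE[i eq]] := zq.
  have qE : q = p + (dir j + dir i) by rewrite eq ez /nb addrA.
  exists (dir j + dir i); split=> //; last first.
    apply/andP; split; last by rewrite -qE; apply/asboolP.
    apply/hasP; exists (j %% 6)%N; last first.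
      by rewrite /nb dir_mod; apply/asboolP; rewrite -[p + _]ez.
    by rewrite mem_filter mem_iota ltn_pmod // dir_mod adjb_dir.
  have := @allI6 (fun j i => [|| dir j + dir i == 0, dir j + dir i \in ring1
                                | dir j + dir i \in ring2]) isT j i.
  rewrite !dir_mod => /or3P[/eqP e|/mapP[k _ e]|//].
    by case: (far 0%N isT); rewrite qE e addr0.
  case: (far 1%N isT); exists q => //; apply/domain_edge; split=> //.
  by rewrite qE e; apply: adjb_dir.
move=> [x [xR -> /andP[/hasP[j jx gj] /asboolP gx]]].
have pj : edge G p (nb p j).
  by apply/domain_edge; split=> //; [exact/asboolP|exact: adjb_dir].
split=> //; split=> //; split.
  exists (nb p j) => //; exists (p + x) => //; apply/domain_edge; split=> //.
    exact/asboolP.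
  by move: jx; rewrite mem_filter /nb adjb_shift => /andP[].
have := allP (isT : all (fun x => (x != 0) && ~~ adjb 0 x) ring2) _ xR.
move=> /andP[/eqP x0 x1] [|[|//]] _.
  by move=> /= e; apply: x0; apply: (addrI p); rewrite addr0.
move=> [z pz /= ez]; subst z; case/domain_edge: pz => _ _.
by rewrite -[X in adjb X _]addr0 adjb_shift (negbTE x1).
Qed.

Lemma sum12 (F : nat -> nat) :
  (\sum_(0 <= j < 12) F j = \sum_(0 <= j < 6) (F (2 * j) + F (2 * j + 1)))%N.
Proof. by rewrite !big_nat_recr //= !big_geq // !add0n !addnA. Qed.

Lemma nb_edges_sphere2 (p : vertex) :
  g p -> nb_edges (sphere G 2 p) = len2 g p.
Proof.
move=> gp; rewrite (@nb_edges_cycle _ p ring2 (at2 p)).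
(* A corner is adjacent to one neighbour of the centre and a middle to two, which matches [at2] with
   [corner] and [middle]. *)
- have nbrs j : (j < 6)%N ->
      [seq i <- iota 0 6 | adjb (dir i) (cyc ring2 (2 * j))] = [:: j] /\
      perm_eq [seq i <- iota 0 6 | adjb (dir i) (cyc ring2 (2 * j + 1))]
              [:: j; (j + 1) %% 6]%N.
    by do 6?case: j => [|j]//.
  have ringE j : (j < 6)%N -> cyc ring2 (2 * j) = dir j + dir j /\
      cyc ring2 (2 * j + 1) = dir j + dir (j + 1).
    by do 6?case: j => [|j]//.
  have c j : (j < 6)%N -> at2 p (cyc ring2 (2 * j)) = corner g p j.
    move=> j6; have [n _] := nbrs j j6; have [r _] := ringE j j6.
    by rewrite /at2 n /= orbF r addrA.
  have m j : (j < 6)%N -> at2 p (cyc ring2 (2 * j + 1)) = middle g p j.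
    move=> j6; have [_ n] := nbrs j j6; have [_ r] := ringE j j6.
    by rewrite /at2 (perm_has _ n) /= orbF r addrA /nb dir_mod.
  (* For [j = 5] the index passes the end of the hexagon and returns to corner 0. *)
  have c' j : (j < 6)%N -> at2 p (cyc ring2 (2 * (j + 1))) = corner g p (j + 1).
    rewrite leq_eqVlt ltnS => /predU1P[[->]|j5]; last by rewrite c // addn1.
    by rewrite /corner !(nbD6 _ 0%N); exact: (c 0%N isT).
  rewrite /len2 (sum12 (fun j => at2 p (cyc ring2 j) && at2 p (cyc ring2 j.+1) : nat)).
  rewrite !big_nat; apply: eq_bigr => j /andP[_ j6].
  have e : ((2 * j + 1).+1 = 2 * (j + 1))%N by lia.
  by rewrite e -(addn1 (2 * j)) c' // c // m.
- exact: ring2_cycle.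
have V := sphere2_verts _ gp.
move=> u v; split=> [[hu hv uv]|].
  have /domain_edge[gu gv auv] := uv.
  have /V[x [xR ux tx]] : verts (sphere G 2 p) u by [].
  have /V[y [yR vy ty]] : verts (sphere G 2 p) v by [].
  by exists x, y; split=> //; move: auv; rewrite ux vy adjb_shift.
move=> [x [y [[xR ux tx] [yR vy ty] xy]]].
have [gu hu] : verts (sphere G 2 p) u by apply/V; exists x.
have [gv hv] : verts (sphere G 2 p) v by apply/V; exists y.
split=> //; apply/domain_edge; split=> //.
by rewrite ux vy adjb_shift.
Qed.

Lemma curvatureE (p : vertex) : boundary G p ->
  curvature G p = \sum_(0 <= j < 6)
     (g (nb p j) && ~~ h (nb p j))%:Z * (3 - (len1 g (nb p j))%:Z).
Proof.
move=> [/asboolP gp hp _]; rewrite /curvature.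
rewrite nb_edges_sphere1 // nb_edges_sphere2 //.
apply: (patch_curvature domain_patch) => //; exact/asboolPn.
Qed.

End DomainPatch.

(** * Lattice sums and double counting *)

Lemma nb_mod (p : vertex) (j : nat) : nb p (j %% 6) = nb p j.
Proof. by rewrite /nb dir_mod. Qed.

Lemma nb_bij (j : nat) : bijective (nb^~ j).
Proof.
exists (nb^~ (j + 3)%N) => p /=; first exact: nb_opp.
by rewrite nbC nb_opp.
Qed.

(** Enlarged by one step, so that a function supported in [A] and all its unit translates are
    supported in [nbhd A]. *)
Definition nbhd (A : {fset vertex}) : {fset vertex} :=
  [fset x in (A : seq vertex) ++ [seq nb v j | v <- A, j <- iota 0 6]]%fset.

Lemma nbhd_sub (A : {fset vertex}) (v : vertex) : v \in A -> v \in nbhd A.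
Proof. by move=> vA; rewrite in_fset /= mem_cat vA. Qed.

Lemma nbhd_nb (A : {fset vertex}) (v : vertex) (j : nat) :
  v \in A -> nb v j \in nbhd A.
Proof.
move=> vA; rewrite in_fset mem_cat; apply/orP; right.
by rewrite -(nb_mod v) allpairs_f // mem_iota ltn_pmod.
Qed.

(** Both sides are sums over the whole lattice, on which a unit translation is a bijection. *)
Lemma sum_shift (A : {fset vertex}) (F : vertex -> int) (j : nat) :
  (forall v, F v != 0 -> v \in A) ->
  \sum_(v <- nbhd A) F (nb v j) = \sum_(v <- nbhd A) F v.
Proof.
move=> FA; have F0 v : v \notin nbhd A -> F v = 0.
  by move=> vA; apply: contraNeq vA => /FA; apply: nbhd_sub.
have Fj0 v : v \notin nbhd A -> F (nb v j) = 0.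
  move=> vA; apply: contraNeq vA => /FA /(nbhd_nb (j + 3)).
  by rewrite nb_opp.
rewrite -[RHS](fsbigTE _ _ F0) -[LHS](fsbigTE _ _ Fj0).
exact/esym/(reindex_fsbigT (nb^~ j) F)/nb_bij.
Qed.

Section Euler.
Variables (A : {fset vertex}) (h : vertex -> bool).
Hypothesis hA : forall v, h v -> v \in A.

Local Notation X v := (Posz (h v)).

Definition ecount (j : nat) : int := \sum_(v <- nbhd A) X v * X (nb v j).

(** Even [j] counts the triangles pointing up, odd [j] those pointing down. *)
Definition tcount (j : nat) : int :=
  \sum_(v <- nbhd A) X v * X (nb v j) * X (nb v (j + 1)).

Let XA (v : vertex) (x : int) : X v * x != 0 -> v \in A.
Proof. by rewrite mulf_eq0; case: (h v) (@hA v) => // ->. Qed.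

Let ecount3 (j : nat) : ecount (j + 3) = ecount j.
Proof.
rewrite /ecount -(@sum_shift A _ j) => [|v]; last exact: XA.
by apply: eq_bigr => v _; rewrite nb_opp mulrC.
Qed.

Let ecount2 (j : nat) :
  \sum_(v <- nbhd A) X (nb v j) * X (nb v (j + 1)) = ecount (j + 2).
Proof.
rewrite /ecount -[RHS](@sum_shift A _ j) => [|v]; last exact: XA.
by apply: eq_bigr => v _; rewrite nb_next.
Qed.

Let tcount2 (j : nat) : tcount (j + 2) = tcount j.
Proof.
rewrite /tcount -(@sum_shift A _ j) => [|v]; last by rewrite -mulrA; exact: XA.
apply: eq_bigr => v _; rewrite nb_next -(addnA j 2%N 1%N) nb_opp.
by rewrite mulrC mulrA.
Qed.

(** With [V], [E], [F] for vertices, edges and triangles where [h] holds, expanding the product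
    gives [6V - 4E - 2E + 6F]: over the six directions each edge is seen twice from its ends and
    twice from an opposite vertex, and each triangle three times. *)
Lemma euler_sum :
  \sum_(v <- nbhd A) (1 - X v) * (\sum_(0 <= j < 6) X (nb v j) -
     2 * \sum_(0 <= j < 6) X (nb v j) * X (nb v (j + 1))) =
  6 * (\sum_(v <- nbhd A) X v - (ecount 0%N + ecount 1%N + ecount 2%N) +
       (tcount 0%N + tcount 1%N)).
Proof.
have XV j : \sum_(v <- nbhd A) X (nb v j) = \sum_(v <- nbhd A) X v.
  by apply: sum_shift => v; rewrite -[X v]mulr1; apply: XA.
transitivity (\sum_(v <- nbhd A) \sum_(0 <= j < 6)
  (X (nb v j) - 2 * (X (nb v j) * X (nb v (j + 1))) -
   X v * X (nb v j) + 2 * (X v * X (nb v j) * X (nb v (j + 1))))).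
  apply: eq_bigr => v _; rewrite mulr_sumr -sumrB mulr_sumr.
  by apply: eq_bigr => j _; ring.
rewrite exchange_big /=.
transitivity (\sum_(0 <= j < 6)
  (\sum_(v <- nbhd A) X v - 2 * ecount (j + 2) - ecount j + 2 * tcount j)).
  apply: eq_bigr => j _; rewrite big_split sumrB sumrB /= -!mulr_sumr.
  by rewrite XV ecount2.
rewrite sum6; set V := \sum_(v <- _) _.
have [e3 e4 e5] : [/\ ecount 3%N = ecount 0%N, ecount 4%N = ecount 1%N
                  & ecount 5%N = ecount 2%N].
  by split; [exact: (ecount3 0)|exact: (ecount3 1)|exact: (ecount3 2)].
have [e6 e7] : ecount 6%N = ecount 0%N /\ ecount 7%N = ecount 1%N.
  by rewrite -e3 -e4; split; [exact: (ecount3 3)|exact: (ecount3 4)].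
have [t2 t3] : tcount 2%N = tcount 0%N /\ tcount 3%N = tcount 1%N.
  by split; [exact: (tcount2 0)|exact: (tcount2 1)].
have [t4 t5] : tcount 4%N = tcount 0%N /\ tcount 5%N = tcount 1%N.
  by rewrite -t2 -t3; split; [exact: (tcount2 2)|exact: (tcount2 3)].
by rewrite !addn2 e6 e7 e3 e4 e5 t2 t3 t4 t5; ring.
Qed.
End Euler.

(** * Total curvature and total turning *)

Section TotalCurvature.
Variables (G : graph vertex) (domG : domain G) (finG : finite_graph G).
Local Notation g := (vertb G).
Local Notation h := (intb G).

Local Notation A := (fset_set (verts G)).

Let gA (v : vertex) : g v -> v \in A.
Proof. by move=> /asboolP gv; rewrite in_fset_set //; exact/mem_set. Qed.

Let hA (v : vertex) : h v -> v \in A.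
Proof. by move=> hv; apply/gA/(patch_int (domain_patch domG)). Qed.

Local Notation B v := (Posz (g v && ~~ h v)).

Lemma boundaryE (p : vertex) : boundary G p <-> g p && ~~ h p.
Proof.
split=> [[gp hp _]|/andP[gp hp]]; last exact: not_interior_boundary.
by apply/andP; split; [exact/asboolP|exact/asboolPn].
Qed.

(** After exchanging the sums, the term $3-s(q)$ is counted once for each boundary neighbour of $q$,
    hence twice. *)
Lemma total_curvature : \sum_(p \in boundary G) curvature G p =
  2 * \sum_(v <- nbhd A) B v * (3 - (len1 g v)%:Z).
Proof.
pose K p := \sum_(0 <= j < 6) B (nb p j) * (3 - (len1 g (nb p j))%:Z).
transitivity (\sum_(p \in boundary G) (B p * K p)).
  apply: eq_fsbigr => p /set_mem bp; rewrite curvatureE //.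
  by move/boundaryE: bp => ->; rewrite mul1r.
rewrite (fsbig_widen _ setT) //; last first.
  by move=> p [_ /boundaryE/negP/negbTE bp] /=; rewrite bp mul0r.
have BA v x : B v * x != 0 -> v \in A.
  by case: (boolP (g v)) => [/gA//|_]; rewrite mul0r eqxx.
rewrite (fsbigTE (nbhd A)); last first.
  by move=> p; apply: contraNeq => /BA; apply: nbhd_sub.
transitivity (\sum_(p <- nbhd A) \sum_(0 <= j < 6)
    (B p * B (nb p j) * (3 - (len1 g (nb p j))%:Z))).
  by apply: eq_bigr => p _; rewrite mulr_sumr; apply: eq_bigr => j _; rewrite mulrA.
rewrite exchange_big /=.
transitivity (\sum_(0 <= j < 6) \sum_(v <- nbhd A)
    (B v * (3 - (len1 g v)%:Z) * B (nb v (j + 3)))).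
  apply: eq_bigr => j _; rewrite -[RHS](@sum_shift A _ j) => [|v].
    by apply: eq_bigr => v _; rewrite nb_opp [RHS]mulrC mulrA.
  by rewrite -mulrA; apply: BA.
rewrite exchange_big mulr_sumr; apply: eq_bigr => v _ /=; rewrite -mulr_sumr.
rewrite mulrC; case: (boolP (g v && ~~ h v)) => [/andP[gv hv]|_]; last first.
  by rewrite mul0r !mulr0.
congr (_ * _); have := patch_bnd_nbrs (domain_patch domG) gv hv.
rewrite -(@sum_rot6 _ (fun j => (g (nb v j) && ~~ h (nb v j) : nat)) 3) => [|k].
  move=> /(congr1 Posz); rewrite (big_morph Posz PoszD (erefl _)) => e.
  rewrite -[RHS]/(Posz 2) -e.
  by apply: eq_bigr => j _; rewrite addnC.
by rewrite !nbD6.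
Qed.

(** This is [euler_sum] read term by term: boundary points contribute their turning by [patch_turn],
    interior points are killed by the factor [1 - X v], and points outside [G] have no interior
    neighbour. *)
Lemma total_turning : \sum_(v <- nbhd A) B v * (3 - (len1 g v)%:Z) =
  6 * (#|` fset_set (interior G)|%:Z -
       (ecount A h 0%N + ecount A h 1%N + ecount A h 2%N) +
       (tcount A h 0%N + tcount A h 1%N)).
Proof.
transitivity (6 * (\sum_(v <- nbhd A) (h v)%:Z -
       (ecount A h 0%N + ecount A h 1%N + ecount A h 2%N) +
       (tcount A h 0%N + tcount A h 1%N))); last first.
  congr (6 * (_ - _ + _)).
  have finI : finite_set (interior G) by apply: sub_finite_set finG => v [].
  have hI v : h v = (v \in fset_set (interior G)).
    by rewrite in_fset_set //; apply/asboolP/idP => /mem_set.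
  rewrite -(fsbigTE (nbhd A)) => [|v]; last first.
    by apply: contraNeq => hv; apply/nbhd_sub/hA; case: (h v) hv.
  rewrite (fsbigTE (fset_set (interior G))) => [|v]; last first.
    by rewrite -hI => /negbTE->.
  rewrite card_fset_sum1 (big_morph Posz PoszD (erefl _)) big_seq [RHS]big_seq.
  by apply: eq_bigr => v; rewrite -hI => ->.
rewrite -(euler_sum hA); apply: eq_bigr => v _.
have PosS (F : nat -> nat) :
    (\sum_(0 <= j < 6) F j)%N%:Z = \sum_(0 <= j < 6) (F j)%:Z.
  by rewrite (big_morph Posz PoszD (erefl _)).
have -> : \sum_(0 <= j < 6) (h (nb v j))%:Z * (h (nb v (j + 1)))%:Z =
    (\sum_(0 <= j < 6) (h (nb v j) && h (nb v (j + 1))))%N%:Z.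
  by rewrite PosS; apply: eq_bigr => j _; rewrite -PoszM mulnb.
have P := domain_patch domG.
case: (boolP (h v)) => hv; first by rewrite andbF subrr !mul0r.
rewrite andbT subr0 mul1r; case: (boolP (g v)) => gv.
  have := congr1 Posz (patch_turn P gv hv); rewrite mul1r -PosS.
  by move=> e; lia.
have h0 j : h (nb v j) = false.
  by apply: contraNF gv => hj; rewrite -(nb_opp v j) (patch_nbr P).
rewrite mul0r big1 => [|j _]; last by rewrite h0.
by rewrite big1 // => j _; rewrite h0.
Qed.
End TotalCurvature.

(** * The rational cochain complex of a finite set of lattice points *)

Section Extension.
Variables (I : choiceType) (S : {fset I}).

Definition ext (f : {ffun S -> rat^o}) (i : I) : rat :=
  if insub i is Some s then f s else 0.

Lemma ext_val (f : {ffun S -> rat^o}) (s : S) : ext f (val s) = f s.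
Proof. by rewrite /ext valK. Qed.

Lemma ext_ffun (F : I -> rat) (i : I) :
  i \in S -> ext [ffun s => F (val s)] i = F i.
Proof. by move=> iS; rewrite /ext insubT ffunE. Qed.

Lemma ext_out (f : {ffun S -> rat^o}) (i : I) : i \notin S -> ext f i = 0.
Proof. by move=> iS; rewrite /ext insubN. Qed.

Lemma ext_linear (a : rat) (f g : {ffun S -> rat^o}) (i : I) :
  ext (a *: f + g) i = a * ext f i + ext g i.
Proof.
rewrite /ext; case: insub => [s|]; first by rewrite !ffunE.
by rewrite mulr0 addr0.
Qed.
End Extension.

Section Cochains.
Variable H : {fset vertex}.

Definition simplices (n : nat) (P : vertex -> nat -> bool) : {fset vertex * nat} :=
  [fset e in [seq (v, j) | v <- H, j <- iota 0 n] | P e.1 e.2]%fset.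

Lemma mem_simplices n (P : vertex -> nat -> bool) v j :
  ((v, j) \in simplices n P) = [&& v \in H, (j < n)%N & P v j].
Proof.
rewrite in_fset /= !inE /= andbA; congr (_ && _).
apply/allpairsP/andP => [[[u i] /= [uH + [-> ->]]]|[vH jn]].
  by rewrite mem_iota.
by exists (v, j); rewrite mem_iota.
Qed.

Lemma card_simplices n (P : vertex -> nat -> bool) :
  #|` simplices n P| = (\sum_(0 <= j < n) \sum_(v <- H) P v j)%N.
Proof.
set s := [seq (v, j) | v <- H, j <- iota 0 n].
have -> : simplices n P = [fset e in [seq e <- s | P e.1 e.2]]%fset.
  by apply/fsetP => e; rewrite !in_fset /= !inE /= mem_filter andbC.
rewrite card_fseq undup_id; last first.
  apply/filter_uniq/allpairs_uniq; [exact: fset_uniq|exact: iota_uniq|].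
  by move=> [? ?] [? ?].
rewrite size_filter -sum1_count big_mkcond big_allpairs exchange_big /=.
rewrite /index_iota subn0; apply: eq_bigr => j _; apply: eq_bigr => v _.
by case: (P v j).
Qed.

(* [(v, j)] stands for the edge from [v] to [nb v j], respectively for the triangle
   on [v], [nb v j], [nb v (j + 1)]; each occurs once for [j < 3], resp. [j < 2]. *)
Definition edges := simplices 3 (fun v j => nb v j \in H).
Definition triangles :=
  simplices 2 (fun v j => (nb v j \in H) && (nb v (j + 1) \in H)).

Implicit Types (phi : {ffun edges -> rat^o}).

(** The value of [phi] on the oriented edge leaving [v] in direction [j]. Only directions 0, 1, 2
    are stored; the others are read from the far end with a minus sign. *)
Definition flow phi (v : vertex) (j : nat) : rat :=
  if (j %% 6 < 3)%N then ext phi (v, j %% 6)%N else - ext phi (nb v j, j %% 6 - 3)%N.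

Lemma flow_linear a phi psi v j :
  flow (a *: phi + psi) v j = a * flow phi v j + flow psi v j.
Proof. by rewrite /flow; case: ifP => _; rewrite ext_linear //; ring. Qed.

Lemma flow_mod phi v j : flow phi v (j %% 6) = flow phi v j.
Proof. by rewrite /flow modn_mod nb_mod. Qed.

Lemma flowD6 phi v j : flow phi v (j + 6) = flow phi v j.
Proof. by rewrite /flow modnDr nbD6. Qed.

Lemma flow_opp phi v j : flow phi (nb v j) (j + 3) = - flow phi v j.
Proof.
rewrite -(nb_mod v) -(flow_mod _ v) -(flow_mod _ _ (j + 3)) -modnDml flow_mod.
move: (j %% 6)%N (ltn_pmod j (isT : 0 < 6)%N) => i i6.
rewrite /flow nb_opp; do 6?case: i i6 => [|i] i6 //=; rewrite ?opprK //.
Qed.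

Definition d0 (f : {ffun H -> rat^o}) : {ffun edges -> rat^o} :=
  [ffun e => ext f (nb (val e).1 (val e).2) - ext f (val e).1].

Definition circ phi v j : rat :=
  flow phi v j + flow phi (nb v j) (j + 2) - flow phi v (j + 1).

Definition d1 phi : {ffun triangles -> rat^o} :=
  [ffun t => circ phi (val t).1 (val t).2].

Lemma d0_linear : linear d0.
Proof.
by move=> a f g; apply/ffunP => e; rewrite !ffunE !ext_linear /GRing.scale /=; ring.
Qed.

Lemma d1_linear : linear d1.
Proof.
by move=> a f g; apply/ffunP => e; rewrite !ffunE /circ !flow_linear /GRing.scale /=; ring.
Qed.

HB.instance Definition _ := GRing.isLinear.Build rat _ _ _ d0 d0_linear.
HB.instance Definition _ := GRing.isLinear.Build rat _ _ _ d1 d1_linear.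

Lemma circ_rot phi v j : circ phi (nb v j) (j + 2) = circ phi v j.
Proof.
rewrite /circ nb_next -(addnA j 2%N 2%N) -(addnA j 2%N 1%N) flow_opp.
rewrite -[(2 + 2)%N]/(1 + 3)%N addnA flow_opp; ring.
Qed.
End Cochains.

(** Rank and nullity of both maps in the exact sequence $0\to K\to U\to V\to W\to 0$. *)
Lemma exact_dim (K : fieldType) (U V W : vectType K) (f : 'Hom(U, V))
    (g : 'Hom(V, W)) (u : U) :
  u != 0 -> (forall x, f x = 0 <-> exists c, x = c *: u) ->
  (forall y, g y = 0 <-> exists x, y = f x) ->
  (forall z, exists y, z = g y) ->
  (dim U + dim W = dim V + 1)%N.
Proof.
move=> u0 kf kg sg.
have -> : dim W = \dim (limg g).
  rewrite -dimvf; congr (\dim _); apply/esym/vspaceP => z.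
  by have [y ->] := sg z; rewrite memv_img ?memvf.
have kfE : lker f = <[u]>%VS.
  apply/vspaceP => x; rewrite memv_ker; apply/eqP/vlineP => [/kf //|[c e]].
  by apply/kf; exists c.
have kgE : lker g = limg f.
  apply/vspaceP => y; rewrite memv_ker; apply/eqP/memv_imgP.
    by move=> /kg [x ->]; exists x; rewrite ?memvf.
  by move=> [x _ ->]; apply/kg; exists x.
rewrite -(dimvf U) -(dimvf V) -(limg_ker_dim f fullv) -(limg_ker_dim g fullv).
by rewrite !capfv kfE kgE dim_vline u0 /=; lia.
Qed.

(** * Coboundaries and closed 1-cochains *)

Section Exactness.
Variable H : {fset vertex}.

Lemma d0E (f : {ffun H -> rat^o}) v j : v \in H -> nb v j \in H ->
  flow (d0 f) v j = ext f (nb v j) - ext f v.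
Proof.
move=> vH wH; rewrite -nb_mod -flow_mod.
rewrite -(nb_mod v) in wH.
move: (j %% 6)%N (ltn_pmod j (isT : 0 < 6)%N) wH => i i6 wH.
have E u k : u \in H -> (k < 3)%N -> nb u k \in H ->
    ext (d0 f) (u, k) = ext f (nb u k) - ext f u.
  move=> uH k3 kH; rewrite (@ext_ffun _ _ (fun e => ext f (nb e.1 e.2) - ext f e.1)) //.
  by rewrite mem_simplices uH k3.
rewrite /flow modn_small //; case: ltnP => i3; first exact: E.
have e : nb (nb v i) (i - 3) = v by rewrite -nbD6 -[RHS](nb_opp v i); congr nb; lia.
by rewrite E ?e //; [ring|lia].
Qed.

Lemma d1d0 (f : {ffun H -> rat^o}) : d1 (d0 f) = 0.
Proof.
apply/ffunP => t; rewrite !ffunE /circ.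
have := fsvalP t; rewrite /=; case: (fsval t) => v j /=.
rewrite mem_simplices => /and4P[vH _ wH uH].
rewrite (d0E f vH wH) (d0E f vH uH) d0E ?nb_next //.
by apply/eqP; rewrite subr_eq0 addrC addrA subrK.
Qed.

(** Triangles are stored only for directions 0 and 1; changing the base vertex shifts the direction
    by 2 and reaches the remaining ones. *)
Lemma circ0 (phi : {ffun edges H -> rat^o}) v j : d1 phi = 0 ->
  v \in H -> nb v j \in H -> nb v (j + 1) \in H -> circ phi v j = 0.
Proof.
move=> phi0; have C u k : (k < 2)%N ->
    u \in H -> nb u k \in H -> nb u (k + 1) \in H ->
    circ phi u k = 0.
  move=> k2 uH kH k1H.
  rewrite -(@ext_ffun _ (triangles H) (fun e => circ phi e.1 e.2) (u, k)).
    rewrite -/(d1 phi) phi0 /ext; case: insub => // s; exact: ffunE.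
  by rewrite mem_simplices uH k2 kH.
pose Q j := forall v, v \in H -> nb v j \in H -> nb v (j + 1) \in H ->
  circ phi v j = 0.
have Qrot k : Q (k + 2)%N -> Q k.
  move=> q u uH kH k1H; rewrite -circ_rot; apply: q; rewrite ?nb_next //.
  by rewrite -addnA nb_opp.
have Q6 k : Q k <-> Q (k + 6)%N.
  have n6 u : nb u (k + 6 + 1) = nb u (k + 1) by rewrite addnAC nbD6.
  have c6 u : circ phi u (k + 6) = circ phi u k.
    by rewrite /circ (addnAC k 6%N 1%N) (addnAC k 6%N 2%N) !nbD6 !flowD6.
  by split=> q u; have := q u; rewrite n6 c6 nbD6.
have Q0 : Q 0%N by move=> u; apply: C.
have Q1 : Q 1%N by move=> u; apply: C.
have Q4 : Q 4%N by apply/Qrot/(Q6 0%N).1.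
have Q5 : Q 5%N by apply/Qrot/(Q6 1%N).1.
suff : Q j by apply.
elim/dir6: j => [|k /Q6//].
by do 6?case=> //; move=> _; apply: Qrot.
Qed.

(* Junk value [0] unless [u] and [v] are adjacent. *)
Definition jump (phi : {ffun edges H -> rat^o}) (u v : vertex) : rat :=
  if v - u \in ring1 then flow phi u (index (v - u) ring1) else 0.

Lemma jump_nb phi u j : jump phi u (nb u j) = flow phi u j.
Proof.
have ringE i : (i < 6)%N -> dir i = nth 0 ring1 i by do 6?case: i => [|i].
rewrite /jump /nb [u + _]addrC addrK -(dir_mod j) -(flow_mod _ _ j).
have j6 : (j %% 6 < 6)%N by rewrite ltn_pmod.
by rewrite ringE // mem_nth // index_uniq.
Qed.

Lemma jumpxx phi u : jump phi u u = 0.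
Proof. by rewrite /jump subrr. Qed.

Lemma jumpC phi u v : adjb u v -> jump phi v u = - jump phi u v.
Proof.
by move=> /nbE[j ->]; rewrite jump_nb -flow_opp -{2}(nb_opp u j) jump_nb.
Qed.

Definition close (u v : vertex) : bool := (u == v) || adjb u v.

Lemma closeC u v : close u v = close v u.
Proof. by rewrite /close eq_sym adjb_sym. Qed.

(** Closedness in the form needed for deformations, where points may coincide. A nondegenerate
    triple is a triangle of either orientation. *)
Lemma jump_triangle phi x y z : d1 phi = 0 ->
  x \in H -> y \in H -> z \in H -> close x y -> close y z -> close x z ->
  jump phi x y + jump phi y z = jump phi x z.
Proof.
move=> phi0 xH yH zH /predU1P[<-|xy]; first by rewrite jumpxx add0r.
move=> /predU1P[<-|yz]; first by rewrite jumpxx addr0.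
move=> /predU1P[<-|xz]; first by rewrite jumpxx (jumpC _ xy) subrr.
have [j yE] := nbE xy; rewrite yE in yH xy yz *.
have T u k : u \in H -> nb u k \in H -> nb u (k + 1) \in H ->
    jump phi u (nb u k) + jump phi (nb u k) (nb u (k + 1)) = jump phi u (nb u (k + 1)).
  move=> uH kH k1H; rewrite [RHS]jump_nb -nb_next !jump_nb.
  by apply/eqP; rewrite -subr_eq0; apply/eqP; apply: circ0.
have [zE|zE] := nb_common xz yz; rewrite zE in zH xz yz *; first exact: T.
have e : nb x j = nb x (j + 5 + 1) by rewrite -addnA nbD6.
rewrite {1 2}e -(T x (j + 5)%N) // -?e // (jumpC _ yz); first ring.
Qed.
End Exactness.

(** * Integrals along curves and their invariance under deformation *)

Section Deformation.
Variables (H : {fset vertex}) (J : vertex -> vertex -> rat).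
Hypothesis Jxx : forall u, J u u = 0.
Hypothesis JT : forall x y z, x \in H -> y \in H -> z \in H ->
  close x y -> close y z -> close x z -> J x y + J y z = J x z.

(** The diagonal from [x k] to [y (ordS k)] cuts the quadrilateral between the two curves into two
    triangles. Summed over the cycle, the rungs from [x] to [y] cancel. *)
Lemma deform_step_sum n (x y : 'I_n -> vertex) :
  deform_step [set` H]%classic x y ->
  \sum_i J (x i) (x (ordS i)) = \sum_i J (y i) (y (ordS i)).
Proof.
move=> [lx ly [i /adjbP xy eq]].
have xH k : x k \in H by case: (lx k).
have yH k : y k \in H by case: (ly k).
have lazyE (z : 'I_n -> vertex) k : lazy_curve [set` H]%classic z -> close (z k) (z (ordS k)).
  by case/(_ k) => _ [->|/adjbP e]; rewrite /close ?eqxx ?e ?orbT.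
have cxy k : close (x k) (y k).
  by rewrite /close; have [->|/eq ->] := eqVneq k i; rewrite ?xy ?eqxx ?orbT.
(* Only one index moves, so one end of the diagonal is shared by both curves, except for [n = 1],
   where [k] is its own successor. *)
have cd k : close (x k) (y (ordS k)).
  have [ki|/eq <-] := eqVneq (ordS k) i; last exact: lazyE.
  have [ki'|/eq ->] := eqVneq k i; last exact: lazyE.
  by rewrite ki ki'.
have e k : J (x k) (x (ordS k)) + J (x (ordS k)) (y (ordS k)) =
           J (x k) (y k) + J (y k) (y (ordS k)).
  by rewrite !JT //; exact: lazyE.
apply: (@addIr _ (\sum_k J (x (ordS k)) (y (ordS k)))).
rewrite -big_split /= (eq_bigr _ (fun k _ => e k)) big_split /= addrC; congr (_ + _).
by rewrite (reindex_inj (@ordS_inj n)).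
Qed.

Lemma contractible_sum n (x : 'I_n -> vertex) :
  contractible [set` H]%classic x -> \sum_i J (x i) (x (ordS i)) = 0.
Proof.
move=> [c xc]; transitivity (\sum_(i < n) J c c); last by rewrite big1.
have inv y z : Relation_Operators.clos_refl_trans _ (@deform_step [set` H]%classic n) y z ->
    \sum_i J (y i) (y (ordS i)) = \sum_i J (z i) (z (ordS i)).
  by elim=> [? ? /deform_step_sum|//|? ? ? _ -> _ ->].
exact: inv xc.
Qed.

Hypothesis contr : forall n (x : 'I_n -> vertex),
  closed_curve [set` H]%classic x -> contractible [set` H]%classic x.

Definition adjH (u v : vertex) : bool := [&& u \in H, v \in H & adjb u v].

Lemma adjHC u v : adjH u v = adjH v u.
Proof. by rewrite /adjH adjb_sym andbCA. Qed.

Fixpoint integral (u : vertex) (s : seq vertex) : rat :=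
  if s is v :: s' then J u v + integral v s' else 0.

Lemma integral_cat u s t : integral u (s ++ t) = integral u s + integral (last u s) t.
Proof. by elim: s u => [|v s IH] u /=; rewrite ?add0r // IH addrA. Qed.

Lemma integral_nth u s :
  integral u s = \sum_(0 <= i < size s) J (nth u (u :: s) i) (nth u (u :: s) i.+1).
Proof.
elim: s u => [|v s IH] u /=; first by rewrite big_nil.
rewrite IH big_nat_recl //; congr (_ + _).
rewrite !big_nat; apply: eq_bigr => i /andP[_ si].
by rewrite -[in RHS]/(nth u (v :: s) i) !(set_nth_default u v) //= ltnW.
Qed.

Lemma integral_closed u s : path adjH u s -> last u s = u -> integral u s = 0.
Proof.
case: s => // v s pus lus; set t := v :: s in pus lus *.
(* The path ends where it starts; dropping its last point leaves a cyclic sequence. *)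
pose x (i : 'I_(size t)) := nth u (u :: t) i.
have xS i : x (ordS i) = nth u (u :: t) i.+1.
  rewrite /x [nat_of_ord (ordS i)](erefl : _ = (i.+1 %% size t)%N).
  move: (nat_of_ord i) (ltn_ord i) => k; rewrite leq_eqVlt.
  move=> /predU1P[->|kt]; last by rewrite modn_small.
  by rewrite modnn -last_nth lus.
have xe i : adjH (x i) (x (ordS i)).
  by rewrite xS; have /(pathP u) := pus; apply.
rewrite integral_nth big_mkord.
have cx : closed_curve [set` H]%classic x.
  by split=> // i; have /and3P[? _ /adjbP] := xe i.
by rewrite -[RHS](contractible_sum (contr cx)); apply: eq_bigr => i _; rewrite xS.
Qed.

Lemma last_rev_belast (u : vertex) s : last (last u s) (rev (belast u s)) = u.
Proof. by case: s => //= v s; rewrite rev_cons last_rcons. Qed.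

Lemma integral_rev u s : path adjH u s ->
  integral (last u s) (rev (belast u s)) = - integral u s.
Proof.
elim: s u => [|v s IH] u /=; first by rewrite oppr0.
move=> /andP[/and3P[uH vH uv] pvs]; rewrite rev_cons -cats1 integral_cat IH //=.
rewrite last_rev_belast addr0 opprD addrC; congr (_ + _).
have cuv : close u v by rewrite /close uv orbT.
(* The degenerate triangle [u], [v], [u] yields antisymmetry of [J]. *)
have := JT uH vH uH cuv; rewrite closeC cuv /close eqxx Jxx => /(_ isT isT) /eqP.
by rewrite addrC addr_eq0 => /eqP.
Qed.

(** The potential is the integral from [b] along a chosen path. The path to [u], the edge to [v] and
    the reversed path from [v] form a closed curve, whose integral is 0. *)
Lemma potential b : (forall v, v \in H -> exists2 s, path adjH b s & v = last b s) ->
  exists f : vertex -> rat, forall u v, adjH u v -> J u v = f v - f u.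
Proof.
move=> conn.
have /choice [s sP] : forall v, exists s : seq vertex,
    v \in H -> path adjH b s /\ v = last b s.
  move=> v; case: (boolP (v \in H)) => [/conn [s ps ls]|_]; last by exists [::].
  by exists s.
exists (fun v => integral b (s v)) => u v uv; have /and3P[uH vH _] := uv.
have [pu lu] := sP u uH; have [pv lv] := sP v vH.
set r := rev (belast b (s v)).
have ir : integral v r = - integral b (s v) by rewrite [X in integral X _]lv integral_rev.
have lr : last v r = b by rewrite [X in last X _]lv last_rev_belast.
have pr : path adjH v r.
  rewrite [X in path _ X]lv rev_path (eq_path (e' := adjH)) // => x y.
  exact: adjHC.
have := @integral_closed b (s u ++ v :: r).
rewrite cat_path pu -lu /= uv pr last_cat /= lr => /(_ isT erefl).
rewrite integral_cat -lu /= ir addrA => /eqP.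
by rewrite subr_eq0 => /eqP e; rewrite /= -e [RHS]addrC addKr.
Qed.

End Deformation.

(** * Exactness and the Euler characteristic *)

Section EulerCharacteristic.
Variable H : {fset vertex}.
Hypothesis contr : forall n (x : 'I_n -> vertex),
  closed_curve [set` H]%classic x -> contractible [set` H]%classic x.
Variable b : vertex.
Hypothesis bH : b \in H.
Hypothesis conn :
  forall v, v \in H -> exists2 s, path (adjH H) b s & v = last b s.

Lemma d0_ker (f : {ffun H -> rat^o}) :
  d0 f = 0 <-> exists c, f = c *: [ffun=> 1].
Proof.
split=> [f0|[c ->]].
  exists (ext f b); apply/ffunP => v; rewrite !ffunE /GRing.scale /= mulr1.
  have [s ps vs] := conn (fsvalP v).
  rewrite -(ext_val f) [val v]vs; elim/last_ind: s ps {vs} => //= s w IH.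
  rewrite rcons_path last_rcons => /andP[/IH <-] /and3P[uH wH /nbE[j ej]].
  rewrite ej in wH *; apply/eqP; rewrite -subr_eq0 -d0E // f0.
  by rewrite /flow; case: ifP => _; rewrite /ext; case: insub => [e|];
    rewrite ?ffunE ?oppr0.
apply/ffunP => e; rewrite !ffunE.
have := fsvalP e; rewrite /=; case: (fsval e) => v j /=.
rewrite mem_simplices => /and3P[vH _ wH].
set k : {ffun H -> rat^o} := _ *: _.
have E u : u \in H -> ext k u = c :> rat.
  move=> uH; have := ext_val k [`uH]%fset; rewrite !ffunE /GRing.scale /= mulr1 => <-.
  by [].
by rewrite !E // subrr.
Qed.

Lemma d1_ker (phi : {ffun edges H -> rat^o}) : d1 phi = 0 <-> exists f, phi = d0 f.
Proof.
split=> [phi0|[f ->]]; last exact: d1d0.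
have [f fP] := @potential H (jump phi) (jumpxx phi)
  (fun x y z => @jump_triangle H phi x y z phi0) contr b conn.
exists [ffun v => f (val v)]; apply/ffunP => e; rewrite -[LHS]ext_val ffunE.
have := fsvalP e; rewrite /=; case: (fsval e) => v j /=.
rewrite mem_simplices => /and3P[vH j3 wH].
rewrite !ext_ffun // -fP; last by rewrite /adjH vH wH adjb_dir.
by rewrite jump_nb /flow modn_small ?j3 // (ltn_trans j3).
Qed.

(** In each horizontal strip the triangles form a row separated by slanted edges. The cochain [phi]
    vanishes on horizontal edges and on a slanted edge sums [psi] over the triangles to its left. *)
Lemma d1_surj (psi : {ffun triangles H -> rat^o}) : exists phi, psi = d1 phi.
Proof.
pose Psi v := ext psi (v, 0%N) + ext psi (v, 1%N).
pose Phi (v : vertex) := \sum_(u <- H | (u.2 == v.2) && (u.1 < v.1)) Psi u.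
have PhiS v : Phi (nb v 0%N) = Phi v + Psi v.
  have dE : nb v 0%N = (v.1 + 1, v.2 + 0) by [].
  rewrite /Phi dE (bigID (pred1 v)) /= addrC addr0; congr (_ + _).
    apply: eq_bigl => -[a c]; case: v {dE} => a' c' /=.
    by rewrite xpair_eqE; case: (c =P c') => _ //=; rewrite andbT; lia.
  transitivity (\sum_(u <- H | u == v) Psi u).
    apply: eq_bigl => -[a c]; case: v {dE} => a' c' /=.
    by rewrite xpair_eqE; case: (c =P c') => _ /=; rewrite ?andbT ?andbF //; lia.
  case: (boolP (v \in H)) => vH.
    by rewrite -big_filter filter_pred1_uniq ?big_seq1 ?fset_uniq.
  rewrite big1_seq => [|u /andP[/eqP-> ]]; last by rewrite (negbTE vH).
  by rewrite /Psi !ext_out ?addr0 // mem_simplices (negbTE vH).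
(* The order within a strip is edge [(v, 2)], triangle [(v, 1)], edge [(v, 1)], triangle [(v, 0)];
   hence only the edge in direction 1 gets the extra term. *)
pose F (e : vertex * nat) :=
  if e.2 is k.+1 then Phi e.1 + (if k is 0 then ext psi (e.1, 1%N) else 0) else 0.
pose phi : {ffun edges H -> rat^o} := [ffun e => F (val e)].
have phiE u k : u \in H -> (k < 3)%N -> nb u k \in H -> ext phi (u, k) = F (u, k).
  by move=> uH k3 kH; rewrite ext_ffun // mem_simplices uH k3.
have phi0 u : ext phi (u, 0%N) = 0.
  by rewrite /ext; case: insubP => // e _ eE; rewrite ffunE eE.
exists phi; apply/ffunP => t; rewrite -[LHS]ext_val ffunE.
have := fsvalP t; rewrite /=; case: (fsval t) => v j /=.
rewrite mem_simplices /circ => /and4P[vH + wH uH].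
case: j wH uH => [|[|//]] wH uH _.
  transitivity (ext phi (v, 0%N) + ext phi (nb v 0%N, 2%N) - ext phi (v, 1%N));
    last by [].
  rewrite phi0 !phiE //; last by rewrite (nb_next v 0%N).
  by rewrite /F /= PhiS /Psi; ring.
transitivity (ext phi (v, 1%N) - ext phi (nb (nb v 1%N) 3, 0%N) - ext phi (v, 2%N));
  last by [].
by rewrite phi0 !phiE // /F /=; ring.
Qed.

Lemma euler_char : (#|` H| + #|` triangles H| = #|` edges H| + 1)%N.
Proof.
have := @exact_dim rat {ffun H -> rat^o} {ffun edges H -> rat^o}
  {ffun triangles H -> rat^o} (linfun (@d0 H)) (linfun (@d1 H)) [ffun=> 1].
rewrite -![dim _]/(#|_| * 1)%N !muln1 -!cardfE; apply.
- apply/eqP => /ffunP/(_ [`bH]%fset); rewrite !ffunE => /eqP.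
  by rewrite oner_eq0.
- by move=> f; rewrite lfunE; exact: d0_ker.
- by move=> phi; rewrite lfunE; split=> [/d1_ker[f ->]|[f ->]];
    [exists f; rewrite lfunE|rewrite lfunE; apply: d1d0].
- by move=> psi; have [phi ->] := d1_surj psi; exists phi; rewrite lfunE.
Qed.
End EulerCharacteristic.

(** * Connectedness of the interior *)

Definition joined (H : {fset vertex}) (u v : vertex) : Prop :=
  exists2 s, path (adjH H) u s & v = last u s.

Lemma joined_refl H u : joined H u u.
Proof. by exists [::]. Qed.

Lemma joined_trans H u v w : joined H u v -> joined H v w -> joined H u w.
Proof.
move=> [s ps ->] [t pt ->]; exists (s ++ t); last by rewrite last_cat.
by rewrite cat_path ps.
Qed.

Lemma joined_sym H u v : joined H u v -> joined H v u.
Proof.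
move=> [s ps ->]; exists (rev (belast u s)); last by rewrite last_rev_belast.
by rewrite rev_path (eq_path (e' := adjH H)) // => x y; apply: adjHC.
Qed.

Lemma joined_step (H : {fset vertex}) u v :
  u \in H -> v \in H -> close u v -> joined H u v.
Proof.
move=> uH vH /predU1P[->|uv]; first exact: joined_refl.
by exists [:: v] => //=; rewrite /adjH uH vH uv.
Qed.

Section Connectivity.
Variables (g h : vertex -> bool) (H : {fset vertex}).
Hypotheses (P : patch g h) (hH : forall v, h v = (v \in H)).

(** Either [p] is interior and links [u] to [v], or the interior neighbours of [p] are the
    consecutive inner vertices of its arc. *)
Lemma joined_near p u v : g p -> h u -> h v -> close p u -> close p v ->
  joined H u v.
Proof.
rewrite !hH => gp hu hv pu pv; case: (boolP (h p)) => hp.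
  rewrite hH in hp; apply: (joined_trans (v := p)); last exact: joined_step.
  by apply: joined_sym; apply: joined_step.
have [i [s [s4 gh]]] := patch_arc P gp hp.
have first_joined k : (0 < k < s)%N -> joined H (nb p (i + 1)) (nb p (i + k)).
  elim: k => // k IH ks; case: (posnP k) => [->|k0]; first exact: joined_refl.
  have ks' : (0 < k < s)%N by rewrite k0 ltnW.
  apply: joined_trans (IH ks') _; apply: joined_step.
  - by rewrite -hH (gh k _).2 //; lia.
  - by rewrite -hH (gh k.+1 _).2 //; lia.
  by rewrite -addn1 addnA -nb_next /close adjb_dir orbT.
have pick w : w \in H -> close p w -> joined H (nb p (i + 1)) w.
  move=> wH /predU1P[pw|/nbE[j wj]]; first by rewrite hH pw wH in hp.
  (* Since 5 is -1 modulo 6, this is [j - i], the position of direction [j] counted from the start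
     of the arc. *)
  have e : w = nb p (i + (j + 5 * i) %% 6).
    rewrite wj -(nb_mod p j) -(nb_mod p (i + _)) modnDmr.
    congr (nb p _); rewrite (_ : (i + (j + 5 * i) = i * 6 + j)%N); last by lia.
    by rewrite modnMDl.
  have k6 : ((j + 5 * i) %% 6 < 6)%N by rewrite ltn_pmod.
  by move: wH; rewrite -hH e (gh _ k6).2; apply: first_joined.
by apply: joined_trans (joined_sym (pick u hu pu)) (pick v hv pv).
Qed.

(** If neither end of the edge is interior, the third vertex of a triangle of the domain on this
    edge is. *)
Lemma common_near p q : g p -> g q -> adjb p q ->
  exists w, [/\ h w, close p w & close q w].
Proof.
move=> gp gq pq; case: (boolP (h p)) => hp.
  by exists p; split=> //; rewrite /close ?eqxx // adjb_sym pq orbT.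
case: (boolP (h q)) => hq; first by exists q; split; rewrite /close ?pq ?eqxx ?orbT.
have [j qE] := nbE pq; rewrite qE in gq hq *.
have [gj|gj] := orP (patch_edge P gp gq).
  exists (nb p (j + 1)); have := patch_tri P gp hp gq gj.
  rewrite (negbTE hq) => /= hw; split=> //; rewrite /close ?adjb_dir ?orbT //.
  by rewrite -nb_next adjb_dir orbT.
have e : nb p (j + 5 + 1) = nb p j by rewrite -addnA nbD6.
exists (nb p (j + 5)); have := patch_tri P gp hp gj; rewrite e => /(_ gq).
rewrite (negbTE hq) orbF => hw; split=> //; rewrite /close ?adjb_dir ?orbT //.
by rewrite -nb_prev adjb_dir orbT.
Qed.
End Connectivity.

(** * The interior of a simply connected domain *)

Section MainProof.
Variables (G : graph vertex) (domG : domain G) (finG : finite_graph G).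
Hypothesis scG : simply_connected G.
Local Notation H := (fset_set (interior G)).
Local Notation A := (fset_set (verts G)).

Lemma finite_interior : finite_set (interior G).
Proof. by apply: sub_finite_set finG => v []. Qed.

Lemma intbE v : intb G v = (v \in H).
Proof.
have fin := finite_interior.
by rewrite in_fset_set //; apply/asboolP/idP => /mem_set.
Qed.

(** A walk in [G] is shadowed by interior points: at each step, one close to both ends of the edge
    takes over. *)
Lemma joined_walk n p q u v : walk G n p q -> vertb G p -> intb G u -> intb G v ->
  close p u -> close q v -> joined H u v.
Proof.
have P := domain_patch domG.
elim: n p u => [|n IH] p u /=; first by move=> ->; apply: (joined_near P intbE).
move=> [z /(domain_edge domG)[_ /asboolP gz pz] zq] gp hu hv pu qv.
have [w [hw pw zw]] := common_near P gp gz pz.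
apply: joined_trans (joined_near P intbE gp hu hw pu pw) _.
exact: (IH z w zq gz hw hv zw qv).
Qed.

Lemma interior_joined u v : u \in H -> v \in H -> joined H u v.
Proof.
rewrite -!intbE => hu hv; have [_ conn _] := scG.
have gI w : intb G w -> verts G w by move=> /asboolP[].
have [n uv] := conn u v (gI u hu) (gI v hv).
by apply: (joined_walk uv) => //; [exact/asboolP/gI|rewrite /close eqxx..].
Qed.

Lemma interior_nonempty : exists b, b \in H.
Proof.
have [[p gp] _ _] := scG; have P := domain_patch domG.
case: (boolP (intb G p)) => hp; first by exists p; rewrite -intbE.
have [j hj] := patch_near P (introT (asboolP _) gp) hp.
by exists (nb p j); rewrite -intbE.
Qed.

Lemma interior_contractible n (x : 'I_n -> vertex) :
  closed_curve [set` H]%classic x -> contractible [set` H]%classic x.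
Proof.
by have fin := finite_interior; rewrite fset_setK //; case: scG => _ _; apply.
Qed.

(** Passes from the integer sums of the double counting to the cardinalities of the cochain
    complex. *)
Lemma sum_interior (F : vertex -> nat) :
  \sum_(v <- nbhd A) (intb G v)%:Z * (F v)%:Z =
  (\sum_(v <- H) F v)%N%:Z.
Proof.
rewrite (big_morph Posz PoszD (erefl _)).
have gA v : intb G v -> v \in fset_set (verts G).
  by move=> /asboolP[gv _]; rewrite in_fset_set //; apply/mem_set.
rewrite -(fsbigTE (nbhd A)) => [|v]; last first.
  apply: contraNeq; case: (boolP (intb G v)) => [/gA/nbhd_sub//|_].
  by rewrite mul0r eqxx.
rewrite (fsbigTE H) => [|v]; last by rewrite -intbE => /negbTE->; rewrite mul0r.
rewrite big_seq [RHS]big_seq; apply: eq_bigr => v; rewrite -intbE => ->.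
by rewrite mul1r.
Qed.

Lemma interior_euler :
  #|` H|%:Z -
  (ecount A (intb G) 0%N + ecount A (intb G) 1%N +
   ecount A (intb G) 2%N) +
  (tcount A (intb G) 0%N + tcount A (intb G) 1%N) = 1.
Proof.
have [b bH] := interior_nonempty.
have := euler_char interior_contractible bH (fun v => interior_joined bH).
have E j : ecount A (intb G) j = (\sum_(v <- H) (nb v j \in H))%N%:Z.
  by rewrite -sum_interior; apply: eq_bigr => v _; rewrite -intbE.
have T j : tcount A (intb G) j =
    (\sum_(v <- H) ((nb v j \in H) && (nb v (j + 1) \in H)))%N%:Z.
  rewrite -sum_interior; apply: eq_bigr => v _.
  by rewrite -!intbE -mulrA -PoszM mulnb.
rewrite !card_simplices !E !T => e.
move: e; rewrite !big_nat_recr //= !big_geq // !add0n => e.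
lia.
Qed.
End MainProof.

Theorem theorem2 (G : graph vertex) (domG : domain G) (finG : finite_graph G)
    (smoothG : smooth G) (scG : simply_connected G) :
  \sum_(p \in boundary G) curvature G p = 12.
Proof.
(* The value arises as 2 times 6 times the Euler characteristic 1. *)
by rewrite total_curvature // total_turning // interior_euler.
Qed.
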